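(* Let $G$ be a connected graph of order $n\geq 3$ with block decomposition $B_1,B_2,\ldots,B_q$ (that is, $B_1,\dots,B_q$ are the blocks of $G$). Let $\mathcal{C}$ be the set of those blocks $X$ of $G$ such that either $X$ is a cycle of order at least $4$ or $4\leq |V(X)|\leq 6$, and let $\mathcal{D}$ be the set of those blocks $X$ of $G$ such that $X$ is not a cycle and $|V(X)|\geq 7$. Then $rx_3(G)\leq n-|\mathcal{C}|-2|\mathcal{D}|-1$. Moreover, the upper bound is tight: there exists a connected graph $G$ of order $n\ge 3$ for which equality holds.
   Context: All graphs are finite, simple and undirected. A block of $G$ is a maximal connected subgraph without a cut vertex of its own (so each block of a connected graph of order at least $2$ is either $K_2$ or a $2$-connected graph). Edge colorings are arbitrary (adjacent edges may receive the same color). In an edge-colored graph $G$, a tree $T\subseteq G$ (a subgraph that is a tree) is a rainbow tree if no two edges of $T$ have the same color. For a connected graph $G$ of order $n\ge 3$, a $3$-rainbow coloring of $G$ is an edge coloring such that for every set $S$ of $3$ vertices of $G$ there is a rainbow tree $T$ in $G$ with $S\subseteq V(T)$. The $3$-rainbow index $rx_3(G)$ is the minimum number of colors in a $3$-rainbow coloring of $G$. *)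

(* Defs.v *)
From HB Require Import structures.
From mathcomp Require Import all_boot all_order all_algebra.

Set Implicit Arguments.
Unset Strict Implicit.
Unset Printing Implicit Defensive.

(* Finite simple graphs whose vertices and edges live in an ambient finite    *)
(* type T: an edge is a 2-element set of vertices.  A graph and all its       *)
(* subgraphs share the ambient type, and graph T is itself a finite type.     *)
Record graph (T : finType) := Graph {
  graph_val : {set T} * {set {set T}};
  graph_wf : [forall f in graph_val.2, (f \subset graph_val.1) && (#|f| == 2)]
}.

HB.instance Definition _ (T : finType) := [isSub for @graph_val T].
HB.instance Definition _ (T : finType) := [Finite of graph T by <:].

Section Graphs.
Variable T : finType.
Implicit Types G H B C X : graph T.

Definition vset G : {set T} := (graph_val G).1.
Definition eset G : {set {set T}} := (graph_val G).2.

Definition subgraph H G := (vset H \subset vset G) && (eset H \subset eset G).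

Definition adj G : rel T := fun x y => [set x; y] \in eset G.

Definition connected G :=
  (vset G != set0) && [forall x in vset G, forall y in vset G, connect (adj G) x y].

Lemma del_vertex_wf G v :
  [forall f in [set f in eset G | v \notin f],
     (f \subset vset G :\ v) && (#|f| == 2)].
Proof.
apply/forallP => f; apply/implyP; rewrite inE => /andP[fG vf].
have /forallP/(_ f)/implyP/(_ fG)/andP[fV f2] := graph_wf G.
by rewrite subsetD1 fV vf.
Qed.

Definition del_vertex G v : graph T :=
  @Graph T (vset G :\ v, [set f in eset G | v \notin f]) (del_vertex_wf G v).

Definition num_components G : nat := n_comp (adj G) (vset G).

Definition cut_vertex G v :=
  (v \in vset G) && (num_components G < num_components (del_vertex G v)).

Definition nonseparable G := connected G && [forall v, ~~ cut_vertex G v].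

Definition is_block G B :=
  [&& subgraph B G, nonseparable B &
      [forall H, [&& subgraph H G, nonseparable H & subgraph B H] ==> (H == B)]].

(* X is a cycle v_0 v_1 ... v_(m-1) v_0 with m >= 3 distinct vertices; the    *)
(* length m of a duplicate-free sequence is at most #|T|.                     *)
Definition is_cycle X :=
  [exists m : 'I_#|T|.+1, exists p : m.-tuple T,
     [&& 2 < m, uniq p, vset X == [set x in p] &
         eset X == [set [set x; next p x] | x in p]]].

Definition is_tree G :=
  connected G && [forall X, subgraph X G ==> ~~ is_cycle X].

(* An edge coloring is given by a function on all of {set T}, of which only   *)
(* the values on eset G matter.                                               *)
Definition rainbow (K : eqType) (c : {set T} -> K) H :=
  [forall f in eset H, forall g in eset H, (c f == c g) ==> (f == g)].

Definition is_3rainbow_coloring (K : eqType) G (c : {set T} -> K) :=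
  [forall S : {set T}, (S \subset vset G) && (#|S| == 3) ==>
     [exists H, [&& subgraph H G, is_tree H, rainbow c H & S \subset vset H]]].

Definition has_3rainbow_coloring G (k : nat) :=
  [exists c : {ffun {set T} -> 'I_k}, is_3rainbow_coloring G c].

Lemma adj_sym G : symmetric (adj G).
Proof. by move=> x y; rewrite /adj setUC. Qed.

Lemma del_edge_wf G f0 :
  [forall f in eset G :\ f0, (f \subset vset G) && (#|f| == 2)].
Proof.
apply/forallP => f; apply/implyP; rewrite in_setD1 => /andP[_ fG].
by have /forallP/(_ f)/implyP/(_ fG) := graph_wf G.
Qed.

Definition del_edge G f0 : graph T :=
  @Graph T (vset G, eset G :\ f0) (del_edge_wf G f0).

Lemma connected_del_cycle_edge G X :
  connected G -> subgraph X G -> is_cycle X ->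
  exists2 f, f \in eset G & connected (del_edge G f).
Proof.
case/andP=> V0 /forall_inP conG /andP[_ sEX].
case/existsP=> m /existsP[p /and4P[m2 Up _ /eqP EX]].
have: 2 < size p by rewrite size_tuple.
have {sEX} : forall x, x \in tval p -> [set x; next p x] \in eset G.
  by move=> x xp; apply: (subsetP sEX); rewrite EX; apply/imsetP; exists x.
case: p Up {EX} => p /= _ Up; move: p Up.
case=> [|a [|b [|d p]]] //= Up nextG _.
have ab : a != b by case/andP: Up; rewrite inE negb_or => /andP[].
have abG : [set a; b] \in eset G.
  by have := nextG a; rewrite /= eqxx; apply; rewrite inE eqxx.
exists [set a; b] => //.
set G' := del_edge G _.
have cycG : cycle (adj G) [:: a, b, d & p].
  by apply: cycle_from_next => //= x; apply: nextG.
have adjG' x y : [set x; y] \in eset G -> (x != a) || (y != b) ->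
    (x != b) || (y != a) -> adj G' x y.
  move=> xyG n1 n2; rewrite /adj in_setD1 xyG andbT.
  apply/eqP => E.
  have xE : x \in [set a; b] by rewrite -E set21.
  have yE : y \in [set a; b] by rewrite -E set22.
  have xy : x != y.
    have /forallP/(_ [set x; y])/implyP/(_ xyG)/andP[_] := graph_wf G.
    by rewrite cards2; case: (x != y).
  move: xE yE n1 n2 xy; rewrite !inE.
  by case/orP=> /eqP-> /orP[] /eqP->; rewrite ?eqxx.
have symG' : connect_sym (adj G') by apply: sym_connect_sym; exact: adj_sym.
have conba : connect (adj G') b a.
  apply/connectP; exists (rcons (d :: p) a); last by rewrite last_rcons.
  case/andP: Up; rewrite inE negb_or => /andP[_ adp] /andP[bdp _].
  have bdG : [set b; d] \in eset G by have := cycG; case/and3P.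
  have : path (adj G) d (rcons p a) by have := cycG; case/and3P.
  have [ad ap] : a != d /\ a \notin p.
    by move: adp; rewrite inE negb_or => /andP[].
  have [bd bp] : b != d /\ b \notin p.
    by move: bdp; rewrite inE negb_or => /andP[].
  rewrite /= adjG' //=; last 2 first.
  - by rewrite eq_sym ab.
  - by rewrite (eq_sym d) ad orbT.
  elim: p d ad bd ap bp {nextG cycG adp bdp bdG} => [|y p IH] d ad bd /=.
    by move=> _ _ /andP[daG _]; rewrite adjG' // (eq_sym d) ?ad ?bd.
  rewrite !inE !negb_or => /andP[ay ap] /andP[yb bp] /andP[dyG pathG].
  by rewrite adjG' ?(eq_sym d) ?ad ?bd //= IH.
rewrite /connected V0; apply/forall_inP => x xG; apply/forall_inP => y yG.
have /forall_inP/(_ y yG) := conG x xG.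
apply: connect_sub => u v uvG.
have [/andP[/eqP-> /eqP->]|n1] := boolP ((u == a) && (v == b)).
  by rewrite symG'.
have [/andP[/eqP-> /eqP->] //|n2] := boolP ((u == b) && (v == a)).
by apply: connect1; apply: adjG' => //; rewrite -negb_and.
Qed.

Lemma subgraph_trans : transitive subgraph.
Proof.
move=> H G X /andP[v1 e1] /andP[v2 e2].
by rewrite /subgraph (subset_trans v1 v2) (subset_trans e1 e2).
Qed.

Lemma spanning_tree G : connected G ->
  exists2 H, subgraph H G & is_tree H /\ vset H = vset G.
Proof.
have [n] := ubnP #|eset G|; elim: n G => // n IH G; rewrite ltnS => leG conG.
have [treeG|] := boolP (is_tree G).
  by exists G; rewrite // /subgraph !subxx.
rewrite /is_tree conG /= negb_forall => /existsP[X].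
rewrite negb_imply negbK => /andP[XG cycX].
have [f fG conG'] := connected_del_cycle_edge conG XG cycX.
have [|//|H HG' [treeH VH]] := IH (del_edge G f).
  by move: leG; rewrite (cardsD1 f) fG.
exists H => //; apply: subgraph_trans HG' _.
by rewrite /subgraph subxx subD1set.
Qed.

Lemma has_3rainbow_coloring_ex G :
  connected G -> exists k, has_3rainbow_coloring G k.
Proof.
move=> conG; exists #|{set T}|.
apply/existsP; exists [ffun f => enum_rank f].
apply/forallP => S; apply/implyP => /andP[SG _].
have [H HG [treeH VH]] := spanning_tree conG.
apply/existsP; exists H; rewrite HG treeH VH SG andbT /=.
apply/forall_inP => f _; apply/forall_inP => g _; apply/implyP.
by rewrite !ffunE => /eqP/enum_rank_inj->.
Qed.

Definition rx3 G (conG : connected G) : nat :=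
  ex_minn (has_3rainbow_coloring_ex conG).

Definition blocksC G : {set graph T} :=
  [set X | is_block G X & (is_cycle X && (4 <= #|vset X|)) || (4 <= #|vset X| <= 6)].

Definition blocksD G : {set graph T} :=
  [set X | is_block G X & ~~ is_cycle X && (7 <= #|vset X|)].

End Graphs.

(* Main.v *)
Require Import Defs.
From mathcomp Require Import all_boot all_order all_algebra.
From mathcomp Require Import zify.

Set Implicit Arguments.
Unset Strict Implicit.
Unset Printing Implicit Defensive.

(* Say that a connected graph of order n has deficiency d when n - d colors   *)
(* suffice. Attaching a pendant vertex or subdividing an edge takes only one  *)
(* more color, so a deficiency passes from a subdivision of a subgraph to the *)
(* whole graph. The cycle C_4 has deficiency 2; the theta graphs with path    *)
(* lengths (2,2,3), (1,3,3), (1,2,5), and K_{2,4}, have deficiency 3. A       *)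
(* nonseparable graph of order at least 4 has a cycle of length at least 4.   *)
(* If it has order at least 7 and is not a cycle, take a longest cycle:       *)
(* together with a chord (if it is spanning) or an ear (if not) it is a       *)
(* subdivision of one of these theta graphs, or else it is K_{2,3}, in which  *)
(* case a second ear gives a subdivision of K_{2,4}. At a cut vertex the      *)
(* deficiencies minus 1 add up, and every block of the graph is a block of    *)
(* one of the two sides, so induction on the order concludes. Equality holds  *)
(* for K_3.                                                                   *)

(** * Colorings linking triples *)

(** The bound says that a connected graph has deficiency 1 + |C| + 2|D| ([connected_deficient]): a
    spanning tree with distinct colors gives 1, and each block adds 0, 1 or 2. The count of vertices
    minus colors is controlled under gluing at a vertex ([rx3_le_glue]), subdividing an edge
    ([rx3_le_subdivide]) and growing to the whole connected graph ([deficient_extend]). The small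
    graphs to start from are colored explicitly and checked by computation ([check_3rainbow_sound]);
    [nonseparable_deficient2] and [nonseparable_deficient3] find subdivisions of them in large
    enough nonseparable graphs, and [deficient_glue] assembles the pieces at cut vertices. Finally
    [has_3rainbow_coloring_of_rx3_le] turns rainbow edge sets into rainbow trees. *)

Section RainbowLinks.
Variable T : finType.
Implicit Types (V S : {set T}) (E F : {set {set T}}).

Definition eadj E : rel T := fun x y => [set x; y] \in E.

Lemma eadj_sym E : connect_sym (eadj E).
Proof. by apply: sym_connect_sym => x y; rewrite /eadj setUC. Qed.

Lemma sub_eadj E F : E \subset F -> subrel (connect (eadj E)) (connect (eadj F)).
Proof.
move=> /subsetP EF; apply: connect_sub => x y xy; apply: connect1.
exact: EF.
Qed.

Lemma eq_set2 (a b c d : T) : [set a; b] = [set c; d] ->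
  (a = c /\ b = d) \/ (a = d /\ b = c).
Proof.
move=> E.
have /set2P aE : a \in [set c; d] by rewrite -E set21.
have /set2P bE : b \in [set c; d] by rewrite -E set22.
have /set2P cE : c \in [set a; b] by rewrite E set21.
have /set2P dE : d \in [set a; b] by rewrite E set22.
by case: aE => aE; case: bE => bE; case: cE => cE; case: dE => dE; subst; auto.
Qed.

(* The trees of a rainbow coloring are replaced by rainbow edge sets F whose  *)
(* colors are below k.  Edges of E may be left unused, so that they need no   *)
(* color, and the property is monotone in E.                                  *)
Definition linked (c : {set T} -> nat) k F S :=
  [/\ {in F &, injective c}, {in F, forall f, c f < k}
    & {in S &, forall x y, connect (eadj F) x y}].

(** Sets of fewer than three vertices are included, so that a single vertex or edge is a legitimate
    piece, and so that the traces of a triple on two glued pieces can be linked separately. *)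
Definition rx3_le V E k := exists c, forall S, S \subset V -> #|S| <= 3 ->
  exists2 F : {set {set T}}, F \subset E & linked c k F S.

Lemma rx3_leS V E E' k : E \subset E' -> rx3_le V E k -> rx3_le V E' k.
Proof.
move=> EE' [c H]; exists c => S SV S3.
by have [F FE FS] := H S SV S3; exists F => //; apply: subset_trans EE'.
Qed.

Lemma rx3_le_point x : rx3_le [set x] set0 0.
Proof.
exists (fun=> 0) => S Sx _; exists set0 => //; split=> [f g|f|y z yS zS].
- by rewrite inE.
- by rewrite inE.
by move/subsetP: Sx => Sx; rewrite (set1P (Sx _ yS)) (set1P (Sx _ zS)).
Qed.

Lemma rx3_le_edge u w : rx3_le [set u; w] [set [set u; w]] 1.
Proof.
exists (fun=> 0) => S /subsetP Suw _; exists [set [set u; w]] => //.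
split=> [f g|//|x y /Suw xS /Suw yS]; first by rewrite !inE => /eqP-> /eqP->.
have uw : connect (eadj [set [set u; w]]) u w.
  by apply: connect1; rewrite /eadj set11.
by case/set2P: xS => ->; case/set2P: yS => -> //; rewrite eadj_sym.
Qed.

(** The two sides use disjoint ranges of colors, so a rainbow set from each side has a rainbow
    union. If S lies in neither side, the trace of S on each side is linked to v there, and v joins
    the two. *)
Lemma rx3_le_glue V1 E1 k1 V2 E2 k2 v :
  rx3_le V1 E1 k1 -> rx3_le V2 E2 k2 -> v \in V1 -> v \in V2 ->
  [disjoint E1 & E2] -> rx3_le (V1 :|: V2) (E1 :|: E2) (k1 + k2).
Proof.
move=> [c1 H1] [c2 H2] v1 v2 dis.
pose c f := if f \in E1 then c1 f else k1 + c2 f.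
have cE2 f : f \in E2 -> c f = k1 + c2 f.
  by move=> fE; rewrite /c (disjointFl dis fE).
have cE1 f : f \in E1 -> c f = c1 f by rewrite /c => ->.
exists c => S SV S3.
have {}H1 S1 : S1 \subset V1 -> #|S1| <= 3 ->
    exists2 F : {set {set T}}, F \subset E1 & linked c k1 F S1.
  move=> SV1 S13; have [F /subsetP FE [inj lt con]] := H1 S1 SV1 S13.
  exists F; first exact/subsetP.
  split=> // [f g fF gF|f fF]; first by rewrite !cE1 ?FE //; apply: inj.
  by rewrite cE1 ?lt ?FE.
have {}H2 S2 : S2 \subset V2 -> #|S2| <= 3 ->
    exists F : {set {set T}}, [/\ F \subset E2, linked c (k1 + k2) F S2 &
                  {in F, forall f, k1 <= c f}].
  move=> SV2 S23; have [F /subsetP FE [inj lt con]] := H2 S2 SV2 S23.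
  exists F; split; first exact/subsetP; last first.
    by move=> f fF; rewrite cE2 ?FE // leq_addr.
  split=> // [f g fF gF|f fF]; last by rewrite cE2 ?FE // ltn_add2l lt.
  by rewrite !cE2 ?FE // => /addnI; apply: inj.
have [SV1|nSV1] := boolP (S \subset V1).
  have [F FE [inj lt con]] := H1 S SV1 S3.
  exists F; first by apply: subset_trans FE (subsetUl _ _).
  by split=> // f fF; apply: leq_trans (lt f fF) (leq_addr _ _).
have [SV2|nSV2] := boolP (S \subset V2).
  have [F [FE FS _]] := H2 S SV2 S3.
  by exists F => //; apply: subset_trans FE (subsetUr _ _).
(* A vertex of S outside V leaves room for v among the three. *)
have card_lt V : ~~ (S \subset V) -> #|v |: (S :&: V)| <= 3.
  rewrite -setD_eq0 -card_gt0 => nS; apply: leq_trans S3.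
  by rewrite -(cardsID V S) cardsU1; case: (v \notin _); lia.
have [|F1 F1E [inj1 lt1 con1]] := H1 (v |: (S :&: V1)) _ (card_lt _ nSV1).
  by rewrite subUset sub1set v1 subsetIr.
have [|F2 [F2E [inj2 lt2 con2] ge2]] := H2 (v |: (S :&: V2)) _ (card_lt _ nSV2).
  by rewrite subUset sub1set v2 subsetIr.
exists (F1 :|: F2); first exact: setUSS.
split=> [f g|f|].
- case/setUP=> fF; case/setUP=> gF; first exact: inj1.
  + by move=> e; have := lt1 f fF; rewrite e ltnNge ge2.
  + by move=> e; have := lt1 g gF; rewrite -e ltnNge ge2.
  exact: inj2.
- by case/setUP=> [/lt1 lt|/lt2//]; apply: leq_trans lt (leq_addr _ _).
suff toV x : x \in S -> connect (eadj (F1 :|: F2)) x v.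
  move=> x y xS yS; apply: connect_trans (toV x xS) _.
  by rewrite eadj_sym; apply: toV.
move=> xS; have /setUP[xV|xV] := subsetP SV x xS.
- by apply: (sub_eadj (subsetUl F1 F2)); apply: con1; rewrite !inE ?eqxx ?xS ?xV ?orbT.
- by apply: (sub_eadj (subsetUr F1 F2)); apply: con2; rewrite !inE ?eqxx ?xS ?xV ?orbT.
Qed.

(* The half [set u; w] inherits the color of [set u; v] and [set w; v] gets   *)
(* the new color, so that a rainbow set linking v also links w.               *)
Lemma rx3_le_subdivide V E k u v w :
  rx3_le V ([set u; v] |: E) k -> {in E, forall f : {set T}, w \notin f} ->
  v \in V -> w \notin V -> u != v -> w != u ->
  rx3_le (w |: V) ([set w; v] |: ([set u; w] |: E)) k.+1.
Proof.
move=> [c H] Ew vV wV uv wu.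
have wv : w != v by apply: contraNneq wV => ->.
pose c' f := if f == [set w; v] then k
             else if f == [set u; w] then c [set u; v] else c f.
pose h f := if f == [set u; v] then [set u; w] else f.
have uw_wv : [set u; w] != [set w; v].
  by apply/eqP => /eq_set2[] [e1 e2]; [move: wu | move: uv]; rewrite e1 eqxx.
exists c' => S SV S3.
pose S' := if w \in S then v |: (S :\ w) else S.
have S'V : S' \subset V.
  have SwV : S :\ w \subset V.
    apply/subsetP => x /setD1P[xw /(subsetP SV)].
    by rewrite !inE (negbTE xw).
  rewrite /S'; case: ifP => [_|wS].
    by rewrite subUset sub1set vV.
  by apply: subset_trans SwV; apply/subsetD1P; rewrite wS.
have S'3 : #|S'| <= 3.
  rewrite /S'; case: ifP => // wS; apply: leq_trans S3.
  by rewrite (cardsD1 w S) wS cardsU1; case: (v \notin _).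
have [F /subsetP FE [inj lt con]] := H S' S'V S'3.
have c'h f : f \in F -> c' (h f) = c f.
  move=> fF; rewrite /c' /h; have [->|fuv] := eqVneq f [set u; v].
    by rewrite (negbTE uw_wv) eqxx.
  have wf : w \notin f.
    by have := FE f fF; rewrite in_setU1 (negbTE fuv) => /Ew.
  rewrite ifN; last by apply: contraNneq wf => ->; rewrite set21.
  by rewrite ifN //; apply: contraNneq wf => ->; rewrite set22.
have c'wv : c' [set w; v] = k by rewrite /c' eqxx.
(* The new edge is always included: its color k does not occur in F, and it turns a use of the edge
   uv into the path u, w, v. *)
pose F' := [set w; v] |: [set h f | f in F].
have F'wv : connect (eadj F') w v by apply: connect1; rewrite /eadj setU11.
have F'F : subrel (connect (eadj F)) (connect (eadj F')).
  apply: connect_sub => x y xyF.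
  have hF' : h [set x; y] \in F' by rewrite in_setU1 imset_f ?orbT.
  move: hF'; rewrite /h; case: eqP => [exy|_] hF'; last exact: connect1.
  have conuv : connect (eadj F') u v by apply: connect_trans (connect1 hF') F'wv.
  by case: (eq_set2 exy) => [] [-> ->] //; rewrite eadj_sym.
exists F'.
  rewrite subUset sub1set setU11 /=; apply/subsetP => _ /imsetP[f fF ->].
  rewrite /h; case: ifP => [_|fuv]; first by rewrite !inE eqxx orbT.
  by have := FE f fF; rewrite in_setU1 fuv /= !inE => ->; rewrite !orbT.
split=> [f g /setU1P[->|/imsetP[f' f'F ->]] /setU1P[->|/imsetP[g' g'F ->]]|f|].
- by [].
- by rewrite c'wv c'h // => e; have := lt g' g'F; rewrite -e ltnn.
- by rewrite c'wv c'h // => e; have := lt f' f'F; rewrite e ltnn.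
- by rewrite !c'h // => /inj->.
- case/setU1P=> [->|/imsetP[f' f'F ->]]; first by rewrite c'wv.
  by rewrite c'h // ltnW // ltnS lt.
have toS' x : x \in S -> exists2 x', x' \in S' & connect (eadj F') x x'.
  move=> xS; rewrite /S'; case: ifP => wS; last by exists x.
  have [->|xw] := eqVneq x w; first by exists v; rewrite ?setU11.
  by exists x; rewrite // !inE xw xS orbT.
move=> x y /toS'[x' x'S xx'] /toS'[y' y'S yy'].
apply: connect_trans xx' _; rewrite eadj_sym; apply: connect_trans yy' _.
by apply: F'F; apply: con.
Qed.

End RainbowLinks.

(** * Subdivision and computed colorings *)

Section EdgeLists.
Variable T : finType.
Implicit Types (s q : seq T) (l : seq (T * T)).

Definition edge_set l : {set {set T}} := [set f in [seq [set p.1; p.2] | p <- l]].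

Definition edges_in s l := all (fun p => (p.1 \in s) && (p.2 \in s)) l.

Definition rx3_seq s l k :=
  [/\ uniq s, edges_in s l & rx3_le [set x in s] (edge_set l) k].

Lemma edge_set_cons u v l : edge_set ((u, v) :: l) = [set u; v] |: edge_set l.
Proof. by apply/setP => f; rewrite !inE. Qed.

Lemma edge_setS l l' : {subset l <= l'} -> edge_set l \subset edge_set l'.
Proof.
move=> sub; apply/subsetP => f; rewrite !inE => /mapP[p pl ->].
by apply: map_f; apply: sub.
Qed.

Lemma edge_set_sub s l f : edges_in s l -> f \in edge_set l -> {subset f <= s}.
Proof.
move=> /allP sl; rewrite inE => /mapP[p /sl/andP[p1 p2] ->] x.
by case/set2P=> ->.
Qed.

Lemma rx3_seq_subdivide q s u v l k :
  rx3_seq s ((u, v) :: l) k -> u != v -> uniq (s ++ q) ->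
  rx3_seq (s ++ q) (l ++ zip (u :: q) (rcons q v)) (k + size q).
Proof.
elim: q s u l k => [|w q IH] s u l k [Us sl H] uv Uq.
  rewrite cats0 addn0; split=> //.
    by move: sl; rewrite /edges_in all_cat /= andbT andbC.
  by apply: rx3_leS H; apply: edge_setS => p; rewrite mem_cat !inE orbC.
case/andP: (sl) => /andP[/= us vs] {}sl.
have ws : w \notin s.
  by move: Uq; rewrite cat_uniq /= negb_or => /and3P[_ /andP[]].
have ws' x : x \in s -> w != x by move=> xs; apply: contraNneq ws => ->.
have Hw : rx3_seq (rcons s w) ((w, v) :: rcons l (u, w)) k.+1.
  split; first by rewrite rcons_uniq ws.
    rewrite /edges_in /= all_rcons /= !mem_rcons !inE eqxx us vs !orbT /=.
    by apply: sub_all sl => p /andP[p1 p2]; rewrite !mem_rcons !inE p1 p2 !orbT.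
  rewrite edge_set_cons in H.
  have := rx3_le_subdivide H (w := w); rewrite !inE ws' // => /(_ _ vs ws uv isT).
  have -> : w |: [set x in s] = [set x in rcons s w].
    by apply/setP => x; rewrite !inE mem_rcons inE.
  have -> : [set w; v] |: ([set u; w] |: edge_set l) =
            edge_set ((w, v) :: rcons l (u, w)).
    rewrite edge_set_cons; congr (_ |: _); apply/setP => f.
    by rewrite !inE map_rcons mem_rcons inE.
  by apply=> f fl; apply: contra ws; apply: (edge_set_sub sl fl).
have := IH (rcons s w) w (rcons l (u, w)) k.+1 Hw; rewrite !cat_rcons addnS.
by apply=> //; apply: ws'.
Qed.

End EdgeLists.

Lemma uniq_map_inj (A B : eqType) (h : A -> B) (s : seq A) :
  uniq (map h s) -> {in s &, injective h}.
Proof.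
elim: s => [|a s IH] //= /andP[ha Us] x y; rewrite !inE.
case/predU1P=> [->|xs] /predU1P[->|ys] // e; last exact: IH e.
- by case/negP: ha; rewrite e map_f.
- by case/negP: ha; rewrite -e map_f.
Qed.

Definition subseqs (A : Type) : seq A -> seq (seq A) :=
  foldr (fun x r => r ++ [seq x :: t | t <- r]) [:: [::]].

Lemma subseqs_sub (A : eqType) (l t : seq A) : t \in subseqs l -> {subset t <= l}.
Proof.
elim: l t => [|a l IH] t /=; first by rewrite inE => /eqP->.
rewrite mem_cat => /orP[/IH tl x /tl xl|/mapP[t' /IH tl ->] x].
  by rewrite inE xl orbT.
by rewrite !inE => /predU1P[->|/tl->]; rewrite ?eqxx ?orbT.
Qed.

(* A colored graph on the vertices 0, ..., n - 1 is a list of pairs           *)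
(* ((endpoint, endpoint), color).                                             *)
Definition reachable n (F : seq (nat * nat * nat)) i :=
  iter n (fun R => [seq v <- iota 0 n | (v \in R) ||
    has (fun p => (p.1.1 == v) && (p.1.2 \in R) ||
                  (p.1.2 == v) && (p.1.1 \in R)) F]) [:: i].

(** Not properness in the usual sense: entries for the same edge, in either orientation, carry the
    same color, so that the list defines a function on edges. *)
Definition proper_coloring (L : seq (nat * nat * nat)) :=
  all (fun p => all (fun q =>
    (p.1 == q.1) || (p.1 == (q.1.2, q.1.1)) ==> (p.2 == q.2)) L) L.

(** Brute force over all rainbow sublists of edges. The sets [Rs] reachable from i are bound once
    for all j and h; repeated indices cover the sets of one or two vertices. *)
Definition check_3rainbow n L k :=
  let Fs := [seq F <- subseqs L | uniq (map snd F)] in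
  [&& all (fun p => [&& p.1.1 < n, p.1.2 < n & p.2 < k]) L, proper_coloring L &
      all (fun i => let Rs := [seq reachable n F i | F <- Fs] in
        all (fun j => all (fun h => has (fun R => (j \in R) && (h \in R)) Rs)
          (iota 0 n)) (iota 0 n)) (iota 0 n)].

Lemma card_le3_sub (T : finType) (S : {set T}) : #|S| <= 3 -> S != set0 ->
  exists x y z, [/\ x \in S, y \in S, z \in S & S \subset [set x; y; z]].
Proof.
move=> S3 /set0Pn[x xS].
have /subsetP S2 : S \subset x |: (S :\ x) by rewrite setD1K.
have {}S3 : #|S :\ x| <= 2 by move: S3; rewrite (cardsD1 x) xS.
have [/eqP S0|[y yS]] := set_0Vmem (S :\ x).
  exists x, x, x; split=> //; apply/subsetP => u /S2.
  by rewrite (eqP S0) !inE orbF => ->.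
have {}S3 : #|S :\ x :\ y| <= 1 by move: S3; rewrite (cardsD1 y) yS.
have yS' : y \in S by case/setD1P: yS.
have [S0|[z zS]] := set_0Vmem (S :\ x :\ y).
  exists x, y, y; split=> //; apply/subsetP => u uS.
  have : u \notin S :\ x :\ y by rewrite S0 inE.
  by rewrite !inE uS andbT negb_and !negbK orbC => /orP[] ->; rewrite ?orbT.
exists x, y, z; split=> //; first by case/setD1P: zS => _ /setD1P[].
apply/subsetP => u uS; rewrite !inE.
have [//|ux] := eqVneq u x; have [//|uy] := eqVneq u y.
have uS' : u \in S :\ x :\ y by rewrite !inE ux uy.
by rewrite (card_le1_eqP S3 _ _ uS' zS) eqxx.
Qed.

Section CheckSound.
Variables (T : finType) (x0 : T) (s : seq T).
Let vtx i := nth x0 s i.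
Let edge (p : nat * nat * nat) := [set vtx p.1.1; vtx p.1.2].

Lemma reachable_connect n F i v :
  v \in reachable n F i -> connect (eadj [set f in map edge F]) (vtx i) (vtx v).
Proof.
rewrite /reachable; elim: {1}n v => [|m IH] v; first by rewrite inE => /eqP->.
rewrite /= mem_filter => /andP[/orP[/IH//|/hasP[p pF /= pv]] _].
have pE : edge p \in [set f in map edge F] by rewrite inE map_f.
case/orP: pv => /andP[/eqP<- /IH iR]; apply: connect_trans iR (connect1 _) => //.
by rewrite /eadj setUC.
Qed.

(** The check concerns indices only; it transfers to any duplicate-free sequence s because [vtx] is
    then injective on the indices below n. *)
Lemma check_3rainbow_sound n L k : check_3rainbow n L k ->
  uniq s -> size s = n -> rx3_seq s [seq (vtx p.1.1, vtx p.1.2) | p <- L] k.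
Proof.
case/and3P=> /allP Ln /allP proper /allP link Us sn.
have vs i : i < n -> vtx i \in s by move=> i_n; rewrite mem_nth ?sn.
have vtx_inj i j : i < n -> j < n -> vtx i = vtx j -> i = j.
  by move=> i_n j_n /eqP; rewrite nth_uniq ?sn // => /eqP.
have edgeP p q : p \in L -> q \in L -> edge p = edge q -> p.2 = q.2.
  move=> pL qL e; apply/eqP; move/allP: (proper p pL) => /(_ q qL)/implyP; apply.
  move: (Ln p pL) (Ln q qL) => /and3P[p1 p2 _] /and3P[q1 q2 _].
  case: p q {pL qL} e p1 p2 q1 q2 => [[p1 p2] a] [[q1 q2] b] /= e n1 n2 n3 n4.
  case: (eq_set2 e) => /= -[/vtx_inj e1 /vtx_inj e2];
    by rewrite e1 // e2 // eqxx ?orbT.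
(* The color of an edge is read off at its first occurrence in L; by [edgeP] any other occurrence
   gives the same. The default 0 is never met on edges of L. *)
pose c f := nth 0 (map snd L) (index f (map edge L)).
have cE p : p \in L -> c (edge p) = p.2.
  move=> pL; have iL : index (edge p) (map edge L) < size L.
    by rewrite -(size_map edge) index_mem map_f.
  rewrite /c (nth_map p) //; apply: edgeP; rewrite ?mem_nth //.
  by rewrite -(nth_map p (edge p)) // nth_index ?map_f.
split=> //.
  by apply/allP => _ /mapP[p /Ln/and3P[p1 p2 _] ->] /=; rewrite !vs.
exists c => S /subsetP SV S3.
have [->|S0] := eqVneq S set0.
  by exists set0; rewrite ?sub0set //; split=> ? ; rewrite inE.
have [x [y [z [xS yS zS /subsetP Sxyz]]]] := card_le3_sub S3 S0.
have inS u : u \in S -> exists2 i, i \in iota 0 n & u = vtx i.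
  move=> /SV; rewrite inE => us; exists (index u s); last by rewrite /vtx nth_index.
  by rewrite mem_iota -sn index_mem.
have [i i_n ex] := inS x xS; have [j j_n ey] := inS y yS.
have [h h_n ez] := inS z zS.
move/allP: (link i i_n) => /(_ j j_n)/allP/(_ h h_n)/hasP[_ /mapP[F + ->]].
rewrite mem_filter => /andP[UF /subseqs_sub FL] /andP[jR hR].
exists [set f in map edge F].
  apply/subsetP => f; rewrite !inE -map_comp => /mapP[p pF ->].
  by apply: (map_f edge); apply: FL.
have xS' u : u \in S -> connect (eadj [set f in map edge F]) x u.
  move=> /Sxyz; rewrite !inE -orbA => /or3P[]/eqP-> //.
    by rewrite ex ey; apply: reachable_connect jR.
  by rewrite ex ez; apply: reachable_connect hR.
split=> [f g|f|u v uS vS].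
- rewrite !inE => /mapP[p pF ->] /mapP[q qF ->].
  by rewrite !cE ?FL // => /(uniq_map_inj UF pF qF)->.
- by rewrite inE => /mapP[p /FL pL ->]; rewrite cE //; case/and3P: (Ln p pL).
by apply: connect_trans (xS' v vS); rewrite eadj_sym xS'.
Qed.

End CheckSound.

Section SmallColorings.
Variable T : finType.
Implicit Types a b c d e f g x y : T.

(** The two colors alternate, so three vertices always lie on a path of two edges of different
    colors. *)
Lemma rx3_C4 a b c d : uniq [:: a; b; c; d] ->
  rx3_seq [:: a; b; c; d] [:: (d, a); (a, b); (b, c); (c, d)] 2.
Proof.
have chk : check_3rainbow 4
  [:: (3, 0, 0); (0, 1, 1); (1, 2, 0); (2, 3, 1)] 2.
  by vm_compute.
by move=> U; have := check_3rainbow_sound a chk U erefl.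
Qed.

(** Here and below, the edges that will be subdivided come first in the list, in the order in which
    [rx3_seq_subdivide] takes them: the last edge of each path that may be longer. *)
Lemma rx3_theta223 x y c d e f : uniq [:: x; y; c; d; e; f] ->
  rx3_seq [:: x; y; c; d; e; f]
    [:: (f, y); (c, y); (d, y); (x, c); (x, d); (x, e); (e, f)] 3.
Proof.
have chk : check_3rainbow 6
  [:: (5, 1, 2); (2, 1, 1); (3, 1, 0); (0, 2, 0); (0, 3, 1); (0, 4, 2);
      (4, 5, 0)] 3.
  by vm_compute.
by move=> U; have := check_3rainbow_sound x chk U erefl.
Qed.

Lemma rx3_theta133 x y a b c d : uniq [:: x; y; a; b; c; d] ->
  rx3_seq [:: x; y; a; b; c; d]
    [:: (b, y); (d, y); (x, y); (x, a); (a, b); (x, c); (c, d)] 3.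
Proof.
have chk : check_3rainbow 6
  [:: (3, 1, 1); (5, 1, 2); (0, 1, 0); (0, 2, 1); (2, 3, 0); (0, 4, 2);
      (4, 5, 0)] 3.
  by vm_compute.
by move=> U; have := check_3rainbow_sound x chk U erefl.
Qed.

Lemma rx3_theta125 x y a b c d e : uniq [:: x; y; a; b; c; d; e] ->
  rx3_seq [:: x; y; a; b; c; d; e]
    [:: (e, y); (x, y); (x, a); (a, y); (x, b); (b, c); (c, d); (d, e)] 4.
Proof.
have chk : check_3rainbow 7
  [:: (6, 1, 3); (0, 1, 0); (0, 2, 1); (2, 1, 2); (0, 3, 2); (3, 4, 3);
      (4, 5, 0); (5, 6, 1)] 4.
  by vm_compute.
by move=> U; have := check_3rainbow_sound x chk U erefl.
Qed.

Lemma rx3_K24 x y a b c d : uniq [:: x; y; a; b; c; d] ->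
  rx3_seq [:: x; y; a; b; c; d]
    [:: (d, y); (x, a); (a, y); (x, b); (b, y); (x, c); (c, y); (x, d)] 3.
Proof.
have chk : check_3rainbow 6
  [:: (5, 1, 0); (0, 2, 0); (2, 1, 1); (0, 3, 0); (3, 1, 2); (0, 4, 1);
      (4, 1, 0); (0, 5, 2)] 3.
  by vm_compute.
by move=> U; have := check_3rainbow_sound x chk U erefl.
Qed.

End SmallColorings.

(** * Ears and deficiency *)

Section GraphConnectivity.
Variable T : finType.
Implicit Types (G H B : graph T) (x y u v w : T) (p q : seq T).

Lemma eset_sub G f : f \in eset G -> f \subset vset G.
Proof. by move=> fG; have /forall_inP/(_ f fG)/andP[] := graph_wf G. Qed.

Lemma adj_neq G x y : adj G x y -> x != y.
Proof.
move=> xyG; have /forall_inP/(_ _ xyG)/andP[_] := graph_wf G.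
by rewrite cards2; case: (x != y).
Qed.

Lemma adj_vset G x y : adj G x y -> (x \in vset G) && (y \in vset G).
Proof.
by move/eset_sub/subsetP=> xyG; rewrite !xyG ?set21 ?set22.
Qed.

Lemma adj_connect_sym G : connect_sym (adj G).
Proof. exact: sym_connect_sym (@adj_sym _ G). Qed.

Lemma path_vset G x p : path (adj G) x p -> {subset p <= vset G}.
Proof.
elim: p x => //= y p IH x /andP[/adj_vset/andP[_ yG] /IH pG] z.
by rewrite inE => /predU1P[->|/pG].
Qed.

Lemma connect_vset G x y : connect (adj G) x y -> x \in vset G -> y \in vset G.
Proof.
move=> /connectP[p /path_vset pG ->] xG.
by have := mem_last x p; rewrite inE => /predU1P[->|/pG].
Qed.

Lemma connectedP G : connected G ->
  (exists x, x \in vset G) /\ {in vset G &, forall x y, connect (adj G) x y}.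
Proof.
case/andP=> /set0Pn V0 /forall_inP con; split=> // x y xG yG.
exact: (forall_inP (con x xG)).
Qed.

Lemma connect_leaves (e : rel T) (A : {set T}) x y :
  connect e x y -> x \in A -> y \notin A ->
  exists u w, [/\ u \in A, w \notin A & e u w].
Proof.
move=> /connectP[p pP ->]; elim: p x pP => /= [x _ ->//|z p IH x /andP[xz pP] xA].
have [zA|zA _] := boolP (z \in A); first exact: IH pP zA.
by exists x, z.
Qed.

Lemma num_components_connected G : connected G -> num_components G = 1.
Proof.
move=> /connectedP[[x xG] con]; rewrite /num_components.
rewrite -(n_comp_connect (@adj_connect_sym G) x); apply: eq_n_comp_r => y.
by apply/idP/idP => [/(con x y xG)|/connect_vset]; [|apply].
Qed.

Lemma num_components_gt1P G : reflect
  (exists x y, [/\ x \in vset G, y \in vset G & ~~ connect (adj G) x y])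
  (1 < num_components G).
Proof.
have sym := @adj_connect_sym G.
apply: (iffP card_gt1P) => [[x [y [/andP[xr xG] /andP[yr yG] xy]]]|].
  exists x, y; split=> //; apply: contraNN xy => /(fingraph.rootP sym) e.
  by rewrite -(eqP xr) -(eqP yr) e.
move=> [x [y [xG yG xy]]]; exists (fingraph.root (adj G) x), (fingraph.root (adj G) y); split.
- by rewrite inE /= roots_root //= (connect_vset (connect_root _ x)).
- by rewrite inE /= roots_root //= (connect_vset (connect_root _ y)).
by apply: contraNneq xy => /(fingraph.rootP sym).
Qed.

(** If v is outside G, no edge is lost; otherwise a second component of G - v would make v a cut
    vertex. *)
Lemma nonseparable_connect G v x y : nonseparable G ->
  x \in vset G -> y \in vset G -> x != v -> y != v ->
  connect (adj (del_vertex G v)) x y.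
Proof.
move=> /andP[conG /forallP/(_ v)] nocut xG yG xv yv.
have [_ con] := connectedP conG.
have [vG|vG] := boolP (v \in vset G); last first.
  apply: connect_sub (con x y xG yG) => a b abG; apply: connect1.
  rewrite /adj inE [_ \in _]abG; apply: contra vG.
  exact: (subsetP (eset_sub abG)).
apply: contraR nocut => xy; rewrite /cut_vertex vG num_components_connected //=.
apply/num_components_gt1P; exists x, y.
by rewrite !in_setD1 xv yv xG yG.
Qed.

Lemma path_del_vertex G v x p : path (adj (del_vertex G v)) x p ->
  path (adj G) x p /\ v \notin p.
Proof.
elim: p x => //= y p IH x /andP[]; rewrite /adj inE => /andP[xyG vxy] /IH[pP vp].
rewrite xyG pP inE negb_or vp !andbT; split=> //.
by apply: contraNneq vxy => ->; rewrite set22.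
Qed.

(** Some edge xw leaves U. As x is no cut vertex, w still reaches another vertex of U in G - x; the
    path is cut at its first vertex y in U, so y differs from x. *)
Lemma exists_ear G (U : {set T}) : nonseparable G -> U \subset vset G ->
  U != vset G -> 1 < #|U| ->
  exists x y q, [/\ x \in U, y \in U & x != y] /\
    [/\ q != [::], uniq q, {in q, forall z, z \notin U} &
        path (adj G) x (rcons q y)].
Proof.
move=> nsG UG neU /card_gt1P[a [b [aU bU ab]]].
have /subsetP UG' := UG.
have [z zG zU] : exists2 z, z \in vset G & z \notin U.
  by apply/subsetPn; apply: contra neU => GU; rewrite eqEsubset UG.
have [/andP[conG _]] := nsG; have [_ con] := connectedP conG.
have [x [w [xU wU xw]]] := connect_leaves (con a z (UG' a aU) zG) aU zU.
have [c cU cx] : exists2 c, c \in U & c != x.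
  by have [eax|] := eqVneq a x; [exists b; rewrite // -eax eq_sym | exists a].
have /andP[_ wG] := adj_vset xw.
have wx : w != x by apply: contraNneq wU => ->.
have /connectP[p0 p0P lastp0] := nonseparable_connect nsG wG (UG' c cU) wx cx.
case/shortenP: p0P lastp0 => p pP Up _ lastp.
have cp : c \in p.
  have := mem_last w p; rewrite -lastp inE => /predU1P[cw|//].
  by rewrite -cw cU in wU.
have hasU : has (mem U) p by apply/hasP; exists c.
case: (split_find hasU) pP Up => y s1 s2 yU s1U.
rewrite cat_path -cat_cons cat_uniq => /andP[/path_del_vertex[s1P xs1] _].
case/andP; rewrite -rcons_cons rcons_uniq => /andP[_ Us1] _.
exists x, y, (w :: s1); split.
  by split=> //; apply: contraNneq xs1 => ->; rewrite mem_rcons mem_head.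
split=> //=; last by rewrite xw.
move=> u; rewrite inE => /predU1P[->//|us1].
by apply: contra s1U => uU; apply/hasP; exists u.
Qed.

Definition deficient G d := exists2 k,
  rx3_le (vset G) (eset G) k & k + d <= #|vset G|.

(** While V is not everything, connectedness gives an edge leaving V; gluing it on costs one color
    and gains one vertex, so k + d <= |V| is preserved. The edges of E lie inside V, hence the new
    edge is not among them. *)
Lemma deficient_extend G (V : {set T}) (E : {set {set T}}) k d :
  connected G -> V != set0 -> V \subset vset G -> E \subset eset G ->
  {in E, forall f : {set T}, f \subset V} ->
  rx3_le V E k -> k + d <= #|V| -> deficient G d.
Proof.
move=> /connectedP[_ con].
have [n] := ubnP (#|vset G| - #|V|); elim: n V E k => // n IH V E k.
move=> leG V0 VG EG EV HV kd.
have [/eqP eVG|neV] := boolP (V == vset G).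
  by exists k; rewrite -?eVG //; apply: rx3_leS HV.
have [z zG zV] : exists2 z, z \in vset G & z \notin V.
  by apply/subsetPn; apply: contra neV => GV; rewrite eqEsubset VG.
have [x xV] := set0Pn _ V0.
have [u [w [uV wV uw]]] := connect_leaves (con x z (subsetP VG x xV) zG) xV zV.
have /andP[_ wG] := adj_vset uw.
have cardw : #|V :|: [set u; w]| = #|V|.+1.
  have -> : V :|: [set u; w] = w |: V.
    apply/setP => y; rewrite !inE; have [->|_] := eqVneq y u.
      by rewrite uV orbT.
    by rewrite orbC.
  by rewrite cardsU1 wV.
have wVG : V :|: [set u; w] \subset vset G.
  by rewrite subUset VG; apply/subsetP => y /set2P[]-> //; apply: (subsetP VG).
have := subset_leq_card wVG; rewrite cardw => ltV.
apply: (IH (V :|: [set u; w]) (E :|: [set [set u; w]]) (k + 1)) => //.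
- by rewrite cardw; move: leG ltV; clear; lia.
- by apply/set0Pn; exists x; rewrite inE xV.
- by rewrite subUset EG sub1set.
- move=> f /setUP[/EV fV|/set1P->]; last exact: subsetUr.
  exact: subset_trans fV (subsetUl _ _).
- apply: rx3_le_glue HV (rx3_le_edge u w) uV (set21 u w) _.
  rewrite disjoint_sym disjoints1; apply: contra wV => /EV/subsetP; apply.
  exact: set22.
by rewrite cardw; move: kd; clear; lia.
Qed.

Lemma deficient_seq G s l k d : connected G ->
  rx3_seq s l k -> {subset s <= vset G} -> all (fun e => adj G e.1 e.2) l ->
  0 < d -> k + d <= size s -> deficient G d.
Proof.
move=> conG [Us sl H] sG /allP lG d0 kd.
have cards : #|[set x in s]| = size s by rewrite cardsE; apply/card_uniqP.
apply: deficient_extend H _ => //; last by rewrite cards.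
- by rewrite -card_gt0 cards; lia.
- by apply/subsetP => x; rewrite inE => /sG.
- by apply/subsetP => f; rewrite inE => /mapP[p /lG pG ->].
by move=> f fl; apply/subsetP => x /(edge_set_sub sl fl); rewrite inE.
Qed.

(** Growing from a single vertex, with no colors, amounts to a spanning tree whose edges all have
    different colors. *)
Lemma deficient1 G : connected G -> deficient G 1.
Proof.
move=> conG; have [[x xG] _] := connectedP conG.
apply: (deficient_extend conG _ _ _ _ (rx3_le_point x)).
- by apply/set0Pn; exists x; rewrite set11.
- by rewrite sub1set.
- exact: sub0set.
- by move=> f; rewrite inE.
by rewrite cards1.
Qed.

End GraphConnectivity.

(** * Subdivisions of the small graphs *)

Section CyclesAndThetas.
Variables (T : finType) (G : graph T).
Implicit Types (x y : T) (p q : seq T).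

Lemma all_zip_path (e : rel T) x q y :
  all (fun u => e u.1 u.2) (zip (x :: q) (rcons q y)) = path e x (rcons q y).
Proof. by elim: q x => [|z q IH] x //=; rewrite -IH. Qed.

Lemma adj_path_rev x q y :
  path (adj G) x (rcons q y) -> path (adj G) y (rcons (rev q) x).
Proof.
move=> qP; have := rev_path (adj G) x (rcons q y).
rewrite last_rcons belast_rcons rev_cons => ->.
by rewrite (eq_path (e' := adj G)) // => u v; rewrite adj_sym.
Qed.

Lemma adj_path_vset x q y : path (adj G) x (rcons q y) ->
  [&& x \in vset G, y \in vset G & all (mem (vset G)) q].
Proof.
move=> qP; have qG := path_vset qP.
apply/and3P; split.
- by case: q qP {qG} => [|z q] /= /andP[/adj_vset/andP[]].
- by apply: qG; rewrite mem_rcons mem_head.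
by apply/allP => z zq; apply: qG; rewrite mem_rcons inE zq orbT.
Qed.

Lemma cycle_deficient p : connected G ->
  cycle (adj G) p -> uniq p -> 4 <= size p -> deficient G 2.
Proof.
move=> conG; case: p => [|a [|b [|c [|d q]]]] // cyc U _.
have da : d != a.
  by apply: contraTneq U => ->; rewrite /= !inE eqxx ?orbT.
have U4 : uniq [:: a; b; c; d].
  by have := U; rewrite -[_ :: _]/([:: a; b; c; d] ++ q) cat_uniq => /andP[].
have H := rx3_seq_subdivide (q := q) (rx3_C4 U4) da U.
have pG : {subset [:: a; b; c; d] ++ q <= vset G}.
  by move=> z zp; apply: (path_vset cyc); rewrite mem_rcons.
apply: (deficient_seq conG H pG) => //; last by rewrite /=; lia.
have /= /and4P[ab bc cd cP] := cyc.
by rewrite /= ?all_cat ?all_zip_path cP /= ab bc cd.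
Qed.

(** The three paths form a subdivision of the theta graph with path lengths (2,2,3); the tail of
    each path is inserted on its last edge. *)
Lemma theta_deficient x y q1 q2 q3 : connected G ->
  uniq (x :: y :: q1 ++ q2 ++ q3) ->
  path (adj G) x (rcons q1 y) -> path (adj G) x (rcons q2 y) ->
  path (adj G) x (rcons q3 y) ->
  1 < size q1 -> 0 < size q2 -> 0 < size q3 -> deficient G 3.
Proof.
move=> conG U P1 P2 P3.
have pG : {subset x :: y :: q1 ++ q2 ++ q3 <= vset G}.
  apply/allP; rewrite /= !all_cat.
  have /and3P[-> -> ->] := adj_path_vset P1.
  by have /and3P[_ _ ->] := adj_path_vset P2; have /and3P[_ _ ->] := adj_path_vset P3.
case: q1 P1 U pG => [|e [|f q1]] // P1; case: q2 P2 => [|c q2] // P2.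
case: q3 P3 => [|d q3] // P3 U pG _ _ _.
(* The six core vertices are put first, then the tails in the order of the subdivisions. *)
have perm : perm_eq (x :: y :: (e :: f :: q1) ++ (c :: q2) ++ (d :: q3))
                    ((([:: x; y; c; d; e; f] ++ q1) ++ q2) ++ q3).
  by apply/permP => P; rewrite /= ?count_cat /= ?count_cat /=; clear; lia.
rewrite (perm_uniq perm) in U.
have U2 : uniq (([:: x; y; c; d; e; f] ++ q1) ++ q2).
  by move: U; rewrite cat_uniq => /andP[].
have U1 : uniq ([:: x; y; c; d; e; f] ++ q1).
  by move: U2; rewrite cat_uniq => /andP[].
have U0 : uniq [:: x; y; c; d; e; f].
  by move: U1; rewrite cat_uniq => /andP[].
have [fy cy dy] : [/\ f != y, c != y & d != y].
  by split; apply: contraTneq U0 => ->; rewrite /= !inE eqxx ?orbT /= ?andbF.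
have H1 := rx3_seq_subdivide (rx3_theta223 U0) fy U1.
have H2 := rx3_seq_subdivide H1 cy U2.
have H3 := rx3_seq_subdivide H2 dy U.
apply: (deficient_seq conG H3).
- by move=> z; rewrite -(perm_mem perm); apply: pG.
- move: P1 P2 P3 => /= /and3P[xe ef P1] /andP[xc P2] /andP[xd P3].
  by rewrite /= ?all_cat ?all_zip_path P1 P2 P3 /= xe ef xc xd.
- by [].
by rewrite !size_cat /=; clear; lia.
Qed.

(** Let q1 be the shorter arc. If it has one inner vertex, the other has at least four, which gives
    a subdivision of theta (1,2,5); otherwise both have at least two, which gives theta (1,3,3). *)
Lemma chord_deficient x y q1 q2 : connected G ->
  uniq (x :: y :: q1 ++ q2) -> adj G x y ->
  path (adj G) x (rcons q1 y) -> path (adj G) x (rcons q2 y) ->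
  0 < size q1 -> 0 < size q2 -> 4 < size q1 + size q2 -> deficient G 3.
Proof.
move=> conG.
wlog le12 : q1 q2 / size q1 <= size q2.
  move=> W U xy P1 P2 s1 s2 s12.
  have [le|/ltnW le] := leqP (size q1) (size q2); first exact: (W q1 q2).
  apply: (W q2 q1) => //; last by rewrite addnC.
  have perm : perm_eq (x :: y :: q2 ++ q1) (x :: y :: q1 ++ q2).
    by rewrite !perm_cons perm_catC.
  by rewrite (perm_uniq perm).
move=> U xy P1 P2 s1 s2 s12.
have pG : {subset x :: y :: q1 ++ q2 <= vset G}.
  apply/allP; rewrite /= !all_cat.
  have /and3P[-> -> ->] := adj_path_vset P1.
  by have /and3P[_ _ ->] := adj_path_vset P2.
case: q1 P1 U pG le12 s1 s12 => [|a [|b q1]] // P1.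
  case: q2 P2 s2 => [|b [|c [|d [|e q2]]]] // P2 _ U pG _ _ _.
  have perm : perm_eq (x :: y :: [:: a] ++ (b :: c :: d :: e :: q2))
                      ([:: x; y; a; b; c; d; e] ++ q2) by [].
  have U0 : uniq [:: x; y; a; b; c; d; e].
    by move: U; rewrite (perm_uniq perm) cat_uniq => /andP[].
  have ey : e != y.
    by apply: contraTneq U0 => ->; rewrite /= !inE eqxx ?orbT /= ?andbF.
  have H := rx3_seq_subdivide (rx3_theta125 U0) ey U.
  apply: (deficient_seq conG H) => //; last by rewrite !size_cat /=; clear; lia.
  move: P1 P2 => /= /and3P[xa ay _] /and5P[xb bc cd de P2].
  by rewrite /= ?all_cat ?all_zip_path P2 /= xy xa ay xb bc cd de.
case: q2 P2 s2 => [|c [|d q2]] // P2 _ U pG _ _ _.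
have perm : perm_eq (x :: y :: (a :: b :: q1) ++ (c :: d :: q2))
                    (([:: x; y; a; b; c; d] ++ q1) ++ q2).
  by apply/permP => P; rewrite /= ?count_cat /= ?count_cat /=; clear; lia.
rewrite (perm_uniq perm) in U.
have U1 : uniq ([:: x; y; a; b; c; d] ++ q1).
  by move: U; rewrite cat_uniq => /andP[].
have U0 : uniq [:: x; y; a; b; c; d].
  by move: U1; rewrite cat_uniq => /andP[].
have [byy dy] : b != y /\ d != y.
  by split; apply: contraTneq U0 => ->; rewrite /= !inE eqxx ?orbT /= ?andbF.
have H1 := rx3_seq_subdivide (rx3_theta133 U0) byy U1.
have H2 := rx3_seq_subdivide H1 dy U.
apply: (deficient_seq conG H2).
- by move=> z; rewrite -(perm_mem perm); apply: pG.
- move: P1 P2 => /= /and3P[xa ab P1] /and3P[xc cd P2].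
  by rewrite /= ?all_cat ?all_zip_path P1 P2 /= xy xa ab xc cd.
- by [].
by rewrite !size_cat /=; clear; lia.
Qed.

Lemma K24_deficient x y a b c q : connected G ->
  uniq (x :: y :: a :: b :: c :: q) ->
  path (adj G) x [:: a; y] -> path (adj G) x [:: b; y] ->
  path (adj G) x [:: c; y] -> path (adj G) x (rcons q y) ->
  0 < size q -> deficient G 3.
Proof.
move=> conG U Pa Pb Pc; case: q U => [|d q] // U P _.
have U0 : uniq [:: x; y; a; b; c; d].
  by have := U; rewrite -[_ :: _]/([:: x; y; a; b; c; d] ++ q) cat_uniq => /andP[].
have dy : d != y.
  by apply: contraTneq U0 => ->; rewrite /= !inE eqxx ?orbT /= ?andbF.
have H := rx3_seq_subdivide (rx3_K24 U0) dy U.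
have aG := path_vset Pa (mem_head a _); have bG := path_vset Pb (mem_head b _).
have cG := path_vset Pc (mem_head c _).
apply: (deficient_seq conG H); last by rewrite !size_cat /=; clear; lia.
- have /= /and4P[xG yG dG qG] := adj_path_vset P.
  by apply/allP; rewrite /= xG yG dG qG aG bG cG.
- move: Pa Pb Pc P => /= /and3P[xa ay _] /and3P[xb yb _] /and3P[xc cy _] /andP[xd P].
  by rewrite /= ?all_cat ?all_zip_path P /= xa ay xb yb xc cy xd.
by [].
Qed.

(** Both arcs are oriented from x to y, whence the reversal of the second. The last two clauses say
    that an empty arc makes x and y consecutive on p; they show that a chord leaves two nonempty
    arcs. *)
Lemma split_cycle p x y : cycle (adj G) p -> uniq p ->
  x \in p -> y \in p -> x != y ->
  exists q1 q2, [/\ perm_eq p (x :: y :: q1 ++ q2),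
    path (adj G) x (rcons q1 y), path (adj G) x (rcons q2 y),
    q1 = [::] -> next p x = y & q2 = [::] -> next p y = x].
Proof.
move=> cyc U xp yp xy; have [i p' ep] := rot_to xp.
have yp' : y \in p'.
  by move: yp; rewrite -(mem_rot i) ep inE eq_sym (negbTE xy).
rewrite -(rot_cycle i) ep in cyc; have U' := U; rewrite -(rot_uniq i) ep in U'.
have nextE := next_rot i U.
have permp : perm_eq p (x :: p') by rewrite -ep perm_sym perm_rot.
case/splitPr: yp' ep cyc U' permp => q1 q2 ep cyc U' permp.
move: (cyc); rewrite /= rcons_cat cat_path /= => /and3P[P1 ly P2].
exists q1, (rev q2); split.
- apply: perm_trans permp _; rewrite perm_cons; apply/permP => P.
  by rewrite /= ?count_cat /= count_rev; clear; lia.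
- by rewrite rcons_path P1.
- exact: adj_path_rev P2.
- by move=> e; rewrite -nextE ep e /= eqxx.
move=> /(congr1 rev); rewrite revK /= => e.
rewrite -nextE ep e; rewrite e in U'.
(* Rotating past [x :: q1] brings y to the front, directly followed by x. *)
rewrite -(next_rot (size (x :: q1)) U') -[x :: q1 ++ _]/((x :: q1) ++ [:: y]).
by rewrite rot_size_cat /= eqxx.
Qed.

Lemma two_paths_cycle x y q1 q2 :
  path (adj G) x (rcons q1 y) -> path (adj G) y (rcons q2 x) ->
  uniq (x :: y :: q1 ++ q2) ->
  exists p, [/\ cycle (adj G) p, uniq p & size p = (size q1 + size q2).+2].
Proof.
move=> P1 P2 U; exists (x :: q1 ++ y :: q2); split.
- by move: P1; rewrite rcons_path /= rcons_cat cat_path /= P2 => /andP[-> ->].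
- have perm : perm_eq (x :: q1 ++ y :: q2) (x :: y :: q1 ++ q2).
    by apply/permP => P; rewrite /= ?count_cat /=; clear; lia.
  by rewrite (perm_uniq perm).
by rewrite /= size_cat /= addnS.
Qed.

Lemma longest_cycle p0 : cycle (adj G) p0 -> uniq p0 ->
  exists p, [/\ cycle (adj G) p, uniq p, size p0 <= size p &
    forall q, cycle (adj G) q -> uniq q -> size q <= size p].
Proof.
move=> cyc0 U0.
pose P m := [exists p : m.-tuple T, cycle (adj G) p && uniq p].
have PE q : cycle (adj G) q -> uniq q -> P (size q).
  by move=> cyc U; apply/existsP; exists (in_tuple q); rewrite cyc U.
have exP : exists m, P m by exists (size p0); apply: PE.
have ubP m : P m -> m <= #|T|.
  case/existsP=> p /andP[_ /card_uniqP]; rewrite size_tuple => <-.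
  exact: max_card.
case: (ex_maxnP exP ubP) => m /existsP[p /andP[cyc U]] maxm.
exists p; rewrite size_tuple; split=> //; first exact/maxm/PE.
by move=> q cycq Uq; apply/maxm/PE.
Qed.

End CyclesAndThetas.

(** * Nonseparable graphs *)

Section NonseparableGraphs.
Variables (T : finType) (G : graph T).
Hypothesis nsG : nonseparable G.
Implicit Types (x y : T) (p q : seq T).

Let conG : connected G. Proof. by case/andP: nsG. Qed.

Lemma ear_of_seq s : {subset s <= vset G} -> uniq s ->
  1 < size s -> size s < #|vset G| ->
  exists x y q, [/\ x \in s, y \in s, uniq (x :: y :: q), 0 < size q &
    {in q, forall z, z \notin s} /\ path (adj G) x (rcons q y)].
Proof.
move=> sG Us s1 ltG; pose U := [set z in s].
have cardU : #|U| = size s by rewrite cardsE; apply/card_uniqP.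
have [|||x [y [q [[xU yU xy] [q0 Uq qU qP]]]]] := @exists_ear _ G U nsG.
- by apply/subsetP => z; rewrite inE => /sG.
- by apply: contraTneq ltG => <-; rewrite cardU ltnn.
- by rewrite cardU.
rewrite !inE in xU yU.
have qs : {in q, forall z, z \notin s} by move=> z /qU; rewrite inE.
exists x, y, q; split=> //; last by case: (q) q0.
rewrite /= inE negb_or xy Uq andbT /=.
by apply/andP; split; apply/negP => /qs; rewrite ?xU ?yU.
Qed.

(** An ear on an edge closes up to a cycle. If that is only a triangle, a fourth vertex yields an
    ear on the triangle, and returning through the third vertex of the triangle gives length at
    least 4. *)
Lemma exists_cycle4 : 4 <= #|vset G| ->
  exists p, [/\ cycle (adj G) p, uniq p & 4 <= size p].
Proof.
move=> G4; have [[a aG] con] := connectedP conG.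
have [b bG ba] : exists2 b, b \in vset G & b != a.
  have : 0 < #|vset G :\ a| by move: G4; rewrite (cardsD1 a) aG; lia.
  by case/card_gt0P=> b /setD1P[]; exists b.
have [u [w [/set1P-> wa aw]]] :
    exists u w, [/\ u \in [set a], w \notin [set a] & adj G u w].
  by apply: connect_leaves (con a b aG bG) _ _; rewrite inE.
have /andP[_ wG] := adj_vset aw; rewrite inE in wa.
have wa' : adj G w a by rewrite adj_sym.
have [||||x [y [q [xs ys U q0 [_ qP]]]]] := @ear_of_seq [:: a; w].
- by apply/allP; rewrite /= aG wG.
- by rewrite /= inE eq_sym wa.
- by [].
- exact: leq_trans G4.
have xy : x != y by move: U; rewrite /= inE negb_or => /andP[/andP[]].
have yx : adj G y x.
  by move: xs ys xy; rewrite !inE => /orP[] /eqP-> /orP[] /eqP->; rewrite ?eqxx.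
have [|q1] := ltnP 1 (size q).
  move=> q2; have [||p [cyc Up sp]] := @two_paths_cycle _ G x y q [::] qP.
  - by rewrite /= yx.
  - by rewrite cats0.
  by exists p; rewrite sp addn0; split.
case: q q0 q1 qP U {xs ys} => [|z [|? ?]] // _ _ /and3P[xz zy _] U.
have zx : adj G z x by rewrite adj_sym.
have yz : adj G y z by rewrite adj_sym.
have xy' : adj G x y by rewrite adj_sym.
have tri u' v' : u' \in [:: x; y; z] -> v' \in [:: x; y; z] -> u' != v' ->
    exists t, [/\ t \in [:: x; y; z], uniq [:: u'; v'; t] & path (adj G) v' [:: t; u']].
  move: U; rewrite /= !inE !negb_or => /and3P[/andP[n1 n2] n3 _].
  have n4 : y != x by rewrite eq_sym.
  have n5 : z != x by rewrite eq_sym.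
  have n6 : z != y by rewrite eq_sym.
  move=> /or3P[] /eqP-> /or3P[] /eqP->; rewrite ?eqxx // => _;
    [exists z | exists y | exists z | exists x | exists y | exists x];
    by rewrite !inE ?eqxx ?orbT ?negb_or ?n1 ?n2 ?n3 ?n4 ?n5 ?n6 ?zx ?yz ?xy' ?xz ?zy ?yx.
have [||||u' [v' [q [us vs Uq q0 [qs qP]]]]] := @ear_of_seq [:: x; y; z].
- have /andP[xG yG] := adj_vset xy'; have /andP[_ zG] := adj_vset xz.
  by apply/allP; rewrite /= xG yG zG.
- by [].
- by [].
- exact: leq_trans G4.
have u'v' : u' != v' by move: Uq; rewrite /= inE negb_or => /andP[/andP[]].
have [t [ts Ut tP]] := tri u' v' us vs u'v'.
have [|p [cyc Up sp]] := @two_paths_cycle _ G u' v' q [:: t] qP tP.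
  rewrite -[u' :: _]/((u' :: v' :: q) ++ [:: t]) cat_uniq Uq /= andbT orbF.
  move: Ut; rewrite /= !inE !negb_or => /and3P[/andP[_ ut] vt _].
  rewrite (eq_sym t u') ut (eq_sym t v') vt /=.
  by apply/negP => /qs; rewrite ts.
by exists p; split=> //; rewrite sp addn1 !ltnS.
Qed.

Lemma nonseparable_deficient2 : 4 <= #|vset G| -> deficient G 2.
Proof. by move=> /exists_cycle4[p [cyc U p4]]; apply: cycle_deficient p4. Qed.

(** If the edges of the spanning cycle were all the edges, G would be a cycle. *)
Lemma chord_of_hamiltonian p : ~~ is_cycle G -> 2 < size p ->
  cycle (adj G) p -> uniq p -> vset G = [set x in p] ->
  exists x y, [/\ adj G x y, next p x != y & next p y != x].
Proof.
move=> ncyc p2 cyc U VG; set E := [set [set x; next p x] | x in p].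
have EG : E \subset eset G.
  by apply/subsetP => _ /imsetP[x xp ->]; apply: next_cycle cyc xp.
have neE : eset G != E.
  apply: contra ncyc => /eqP EE.
  have szp : size p < #|T|.+1 by rewrite -(card_uniqP U) ltnS max_card.
  apply/existsP; exists (Ordinal szp); apply/existsP; exists (in_tuple p).
  by rewrite /= p2 U VG EE !eqxx.
have [f fG fE] : exists2 f, f \in eset G & f \notin E.
  by apply/subsetPn; apply: contra neE => GE; rewrite eqEsubset GE.
have /cards2P[x [y [xy ef]]] : #|f| == 2.
  by have /forall_inP/(_ f fG)/andP[] := graph_wf G.
rewrite ef in fG fE.
have [xp yp] : x \in p /\ y \in p.
  by have /andP[] := adj_vset (fG : adj G x y); rewrite VG !inE.
exists x, y; split=> //; apply: contra fE => /eqP<-; apply/imsetP.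
- by exists x.
by exists y; rewrite // setUC.
Qed.

(* An ear that does not join x to y would close up, through the K_{2,3}, to a *)
(* cycle of length at least 5.                                                *)
Lemma K23_ear_deficient x y a b c u v q :
  (forall p, cycle (adj G) p -> uniq p -> size p <= 4) ->
  uniq [:: x; y; a; b; c] ->
  path (adj G) x [:: a; y] -> path (adj G) x [:: b; y] ->
  path (adj G) x [:: c; y] ->
  u \in [:: x; y; a; b; c] -> v \in [:: x; y; a; b; c] -> uniq (u :: v :: q) ->
  0 < size q -> {in q, forall z, z \notin [:: x; y; a; b; c]} ->
  path (adj G) u (rcons q v) -> deficient G 3.
Proof.
move=> max4 U Pa Pb Pc uU vU Uq q0 qU qP.
(* A path back from v to u inside the K_{2,3} with two inner vertices closes the ear to a cycle of
   length at least 5. *)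
have close r : 1 < size r -> uniq [:: u, v & r] ->
    {subset r <= [:: x; y; a; b; c]} -> path (adj G) v (rcons r u) -> False.
  move=> r2 Ur rU rP.
  have [|p [cyc Up sp]] := two_paths_cycle qP rP.
    rewrite -!cat_cons cat_uniq Uq; move: Ur; rewrite -[[:: u, v & r]]/([:: u; v] ++ r).
    rewrite cat_uniq => /and3P[_ uvr ->]; rewrite andbT /= -all_predC.
    apply/allP => z zr /=; rewrite !inE.
    have zq : z \notin q by apply/negP => /qU; rewrite rU.
    move/hasPn: uvr => /(_ z zr); rewrite /= !inE.
    by rewrite !negb_or zq andbT.
  have := max4 p cyc Up; rewrite sp !ltnS leqNgt => /negP; apply.
  by rewrite -addn2 in r2 *; apply: leq_add q0 r2.
move: (Pa) (Pb) (Pc) => /= /and3P[xa ay _] /and3P[xb yb _] /and3P[xc cy _].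
have symP u' v' : adj G u' v' -> adj G v' u' by rewrite adj_sym.
have adjs := (xa, ay, xb, yb, xc, cy, symP _ _ xa, symP _ _ ay, symP _ _ xb,
              symP _ _ yb, symP _ _ xc, symP _ _ cy).
have K23 : uniq (x :: y :: a :: b :: c :: q).
  rewrite -[_ :: _]/([:: x; y; a; b; c] ++ q) cat_uniq U -all_predC /=.
  by move: Uq => /= /and3P[_ _ ->]; rewrite andbT; apply/allP => z /qU.
have dist : [/\ x != y, x != a, x != b, x != c &
    [/\ y != a, y != b, y != c, a != b & a != c /\ b != c]].
  move: U; rewrite /= !inE !negb_or.
  by case/and5P=> /and4P[-> -> -> ->] /and3P[-> -> ->] /andP[-> ->] ->.
case: dist => [d1 d2 d3 d4 [d5 d6 d7 d8 [d9 d10]]].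
have sym_neq (u' v' : T) : u' != v' -> (v' == u') = false.
  by rewrite eq_sym => /negbTE.
have neqs := (negbTE d1, negbTE d2, negbTE d3, negbTE d4, negbTE d5, negbTE d6,
  negbTE d7, negbTE d8, negbTE d9, negbTE d10, sym_neq _ _ d1, sym_neq _ _ d2,
  sym_neq _ _ d3, sym_neq _ _ d4, sym_neq _ _ d5, sym_neq _ _ d6,
  sym_neq _ _ d7, sym_neq _ _ d8, sym_neq _ _ d9, sym_neq _ _ d10).
have solve r : 1 < size r -> all (mem [:: x; y; a; b; c]) r -> uniq [:: u, v & r] ->
    path (adj G) v (rcons r u) -> deficient G 3.
  by move=> r1 /allP rU Ur rP; case: (close r r1 Ur rU rP).
have uv : u != v by move: Uq; rewrite /= inE negb_or => /andP[/andP[]].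
move: uU vU uv; rewrite !inE.
move=> /or4P[/eqP eu|/eqP eu|/eqP eu|/orP[]/eqP eu]
  /or4P[/eqP ev|/eqP ev|/eqP ev|/orP[]/eqP ev];
  rewrite eu ev ?eqxx // => _; rewrite ?eu ?ev in solve qP.
all: try exact: K24_deficient K23 Pa Pb Pc qP q0.
(* All remaining pairs of ends except (y, x) contradict maximality: a return path with at least two
   inner vertices is found among these candidates; three are needed when both ends are among a, b,
   c. *)
all: try (let t r := (apply: (solve r);
    rewrite /= ?inE ?neqs ?adjs ?eqxx ?orbT //; fail) in
  first [ t [:: y; b] | t [:: y; a] | t [:: x; b] | t [:: x; a]
        | t [:: b; y] | t [:: a; y] | t [:: b; x] | t [:: a; x]
        | t [:: y; c; x] | t [:: y; b; x] | t [:: y; a; x] ]).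
(* The ear runs from y to x, so it is reversed. *)
apply: K24_deficient Pa Pb Pc (adj_path_rev qP) _ => //; last by rewrite size_rev.
have perm : perm_eq [:: x, y, a, b, c & rev q] [:: x, y, a, b, c & q].
  by rewrite !perm_cons perm_rev.
by rewrite (perm_uniq perm).
Qed.

(** If a longest cycle p is spanning, it has a chord. Otherwise take an ear: by maximality each arc
    of p between its ends has at least as many inner vertices as the ear. An arc with two inner
    vertices gives a theta (2,2,3); otherwise all three paths have one inner vertex, the graph found
    is K_{2,3}, and order at least 7 leaves room for a second ear. *)
Lemma nonseparable_deficient3 :
  ~~ is_cycle G -> 7 <= #|vset G| -> deficient G 3.
Proof.
move=> ncyc G7; have [|p0 [cyc0 U0 p04]] := exists_cycle4.
  exact: leq_trans G7.
have [p [cyc U p0p maxp]] := longest_cycle cyc0 U0.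
have p4 := leq_trans p04 p0p.
have pG : {subset p <= vset G}.
  case: (p) cyc => // a p' cyc z zp.
  by apply: (path_vset cyc); rewrite mem_rcons.
have cardp : #|[set x in p]| = size p by rewrite cardsE; apply/card_uniqP.
have lepG : [set x in p] \subset vset G by apply/subsetP => z; rewrite inE => /pG.
have [VG|neV] := eqVneq [set x in p] (vset G).
  have [x [y [xy nx ny]]] :=
    chord_of_hamiltonian ncyc (leq_trans (leqnSn 3) p4) cyc U (esym VG).
  have [xp yp] : x \in p /\ y \in p.
    by have /andP[] := adj_vset xy; rewrite -VG !inE.
  have [q1 [q2 [perm P1 P2 n1 n2]]] := split_cycle cyc U xp yp (adj_neq xy).
  have szp := perm_size perm; rewrite /= size_cat in szp.
  apply: chord_deficient xy P1 P2 _ _ _ => //.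
  - by rewrite -(perm_uniq perm).
  - by rewrite lt0n size_eq0; apply: contra nx => /eqP/n1->.
  - by rewrite lt0n size_eq0; apply: contra ny => /eqP/n2->.
  by move: G7; rewrite -VG cardp szp !ltnS.
have ltp : size p < #|vset G| by rewrite -cardp proper_card // properEneq neV.
have [|x [y [q [xp yp Uq q0 [qp qP]]]]] := ear_of_seq pG U _ ltp.
  by apply: leq_trans p4.
have xy : x != y by move: Uq; rewrite /= inE negb_or => /andP[/andP[]].
have [q1 [q2 [perm P1 P2 _ _]]] := split_cycle cyc U xp yp xy.
have szp := perm_size perm; rewrite /= size_cat in szp.
have U123 : uniq (x :: y :: q1 ++ q2 ++ q).
  rewrite catA -2!cat_cons cat_uniq -(perm_uniq perm) U.
  move: (Uq) => /= /and3P[_ _ ->]; rewrite andbT -all_predC.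
  by apply/allP => z /qp; rewrite (perm_mem perm).
(* An arc q' and the ear form a cycle, which is no longer than p. *)
have le_q q' : path (adj G) x (rcons q' y) -> uniq (x :: y :: q' ++ q) ->
    size q' + size q <= size q1 + size q2.
  move=> P U'; have [|p' [cyc' Up' sp']] := two_paths_cycle P (adj_path_rev qP).
    have perm' : perm_eq [:: x, y & q' ++ rev q] [:: x, y & q' ++ q].
      by rewrite !perm_cons perm_cat2l perm_rev.
    by rewrite (perm_uniq perm').
  by have := maxp p' cyc' Up'; rewrite sp' szp size_rev !ltnS.
have le1 : size q <= size q2.
  rewrite -(leq_add2l (size q1)); apply: le_q P1 _.
  by apply: subseq_uniq U123; rewrite /= !eqxx cat_subseq // suffix_subseq.
have le2 : size q <= size q1.
  rewrite -(leq_add2r (size q2)) addnC; apply: le_q P2 _.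
  by apply: subseq_uniq U123; rewrite /= !eqxx suffix_subseq.
have q10 := leq_trans q0 le2; have q20 := leq_trans q0 le1.
have [q11|q11] := ltnP 1 (size q1); first exact: theta_deficient U123 P1 P2 qP q11 q20 q0.
have [q21|q21] := ltnP 1 (size q2).
  apply: theta_deficient P2 P1 qP q21 q10 q0 => //.
  have perm' : perm_eq [:: x, y & q2 ++ q1 ++ q] [:: x, y & q1 ++ q2 ++ q].
    by rewrite !perm_cons perm_catCA.
  by rewrite (perm_uniq perm').
have sizep : size p = 4 by rewrite szp; case: (q1) (q2) q10 q20 q11 q21 => [|? []] // [|? []].
rewrite sizep in maxp; clear - nsG conG G7 maxp U123 P1 P2 qP q0 q10 q20 q11 q21 le1 xy.
move: le1 => /leq_trans/(_ q21) q1'.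
case: q1 q2 q q10 q20 q0 q11 q21 q1' U123 P1 P2 qP => [|a [|]] // [|b [|]] // [|c [|]] //.
move=> _ _ _ _ _ _ U Pa Pb Pc.
have [||||u [v [r [uU vU Ur r0 [rU rP]]]]] := @ear_of_seq [:: x; y; a; b; c].
- have /andP[xG aG] : (x \in vset G) && (a \in vset G).
    by move: Pa => /andP[/adj_vset].
  have [[bG cG] yG] := (path_vset Pb (mem_head b _), path_vset Pc (mem_head c _),
    path_vset Pa (mem_last a [:: y] : y \in [:: a; y])).
  have /allP : all (mem (vset G)) [:: x; y; a; b; c] by rewrite /= xG yG aG bG cG.
  exact.
- exact: U.
- by [].
- exact: leq_trans G7.
exact: (K23_ear_deficient (x := x) maxp U Pa Pb Pc uU vU Ur r0 rU rP).
Qed.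

End NonseparableGraphs.

(** * Cut vertices and blocks *)

Section BlockInduction.
Variable T : finType.
Implicit Types (G B H : graph T) (A C : {set T}) (v x y : T).

Lemma induced_wf G A : [forall f in [set f in eset G | f \subset A],
  (f \subset vset G :&: A) && (#|f| == 2)].
Proof.
apply/forall_inP => f; rewrite inE => /andP[fG fA].
by have /forall_inP/(_ f fG)/andP[fV ->] := graph_wf G; rewrite subsetI fV fA.
Qed.

Definition induced G A : graph T :=
  @Graph T (vset G :&: A, [set f in eset G | f \subset A]) (induced_wf G A).

Lemma vset_induced G A : vset (induced G A) = vset G :&: A.
Proof. by []. Qed.

Lemma induced_subgraph G A : subgraph (induced G A) G.
Proof.
by rewrite /subgraph subsetIl; apply/subsetP => f; rewrite inE => /andP[].
Qed.

Lemma subgraph_induced G A B :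
  subgraph B G -> vset B \subset A -> subgraph B (induced G A).
Proof.
case/andP=> VBG /subsetP EBG BA; rewrite /subgraph subsetI VBG BA.
by apply/subsetP => f fB; rewrite inE EBG // (subset_trans (eset_sub fB) BA).
Qed.

(** A path in G from a vertex of C to v stays in C until it first meets v, since edges leave C only
    towards v. *)
Lemma induced_connected G v C : connected G -> v \in vset G ->
  C \subset vset G -> {in C, forall x y, adj G x y -> y != v -> y \in C} ->
  connected (induced G (v |: C)).
Proof.
move=> /connectedP[_ con] vG /subsetP CG clC; set H := induced _ _.
have toV x : x \in vset H -> connect (adj H) x v.
  rewrite !inE => /andP[xG /predU1P[->//|xC]].
  have /connectP[p pP lastp] := con x v xG vG.
  elim: p x xC pP lastp {xG} => [|y p IH] x xC /=; first by move=> _ ->.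
  move=> /andP[xy pP] lastp.
  have xyH : y \in v |: C -> adj H x y.
    move=> yC; rewrite /adj inE; apply/andP; split; first exact: xy.
    by apply/subsetP => z /set2P[]-> //; rewrite !inE xC orbT.
  have [eyv|yv] := eqVneq y v.
    by rewrite -eyv; apply/connect1/xyH; rewrite eyv setU11.
  have yC := clC x xC y xy yv.
  by apply: connect_trans (connect1 (xyH _)) (IH y yC pP lastp); rewrite !inE yC orbT.
apply/andP; split; first by apply/set0Pn; exists v; rewrite !inE vG eqxx.
apply/forall_inP => x /toV xv; apply/forall_inP => y /toV yv.
by apply: connect_trans xv _; rewrite adj_connect_sym.
Qed.

(** C1 is one component of G - v for a cut vertex v, and C2 is the union of all the others. *)
Lemma separable_split G : connected G -> ~~ nonseparable G ->
  exists v C1 C2, [/\ v \in vset G, vset G = v |: (C1 :|: C2) &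
    [/\ v \notin C1 :|: C2, [disjoint C1 & C2], C1 != set0 & C2 != set0] /\
    forall x y, x \in C1 -> y \in C2 -> ~~ connect (adj (del_vertex G v)) x y].
Proof.
move=> conG; rewrite /nonseparable conG negb_forall /= => /existsP[v].
rewrite negbK => /andP[vG]; rewrite num_components_connected //.
move=> /num_components_gt1P[a [b [aG bG ab]]]; set G' := del_vertex G v in aG bG ab *.
pose C1 := [set x in vset G' | connect (adj G') a x].
have C12 : C1 :|: (vset G' :\: C1) = vset G :\ v.
  have /setIidPr C1G : C1 \subset vset G' by apply/subsetP => x; rewrite inE => /andP[].
  by rewrite -{1}C1G setID.
exists v, C1, (vset G' :\: C1); split=> //; first by rewrite C12 setD1K.
split; first split.
- by rewrite C12 setD11.
- by rewrite -setI_eq0 setIC setIDAC setDIl setDv setI0.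
- by apply/set0Pn; exists a; rewrite inE aG /=.
- by apply/set0Pn; exists b; rewrite in_setD bG andbT inE (negbTE ab) andbF.
move=> x y xC1 /setDP[yG yC1]; move: xC1; rewrite inE => /andP[_ ax].
by apply: contra yC1 => xy; rewrite inE yG; apply: connect_trans ax xy.
Qed.

Lemma block_induced G B A : is_block G B -> vset B \subset A ->
  is_block (induced G A) B.
Proof.
case/and3P=> BG nsB /forallP maxB BA; apply/and3P; split=> //.
  exact: subgraph_induced.
apply/forallP => H; apply/implyP => /and3P[HA nsH BH].
move/implyP: (maxB H); apply; rewrite nsH BH !andbT.
exact: subgraph_trans HA (induced_subgraph G A).
Qed.

Lemma nonseparable_block G B : nonseparable G -> is_block G B -> B = G.
Proof.
move=> nsG /and3P[BG _ /forallP/(_ G)/implyP maxB]; apply/esym/eqP/maxB.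
by rewrite /subgraph !subxx nsG.
Qed.

Lemma deficientW G d d' : d' <= d -> deficient G d -> deficient G d'.
Proof. by move=> dd' [k H kd]; exists k => //; lia. Qed.

(** The only block is G itself, and it cannot lie in both families; so the required deficiency is 1,
    2 or 3. *)
Lemma block_deficient G : nonseparable G ->
  deficient G (#|blocksC G| + 2 * #|blocksD G| + 1).
Proof.
move=> nsG; have conG : connected G by case/andP: nsG.
(* The boolean b is read as a number: S is empty if b is false and contained in {G} if b is true. *)
have card_le1 (S : {set graph T}) (b : bool) :
    (forall X, X \in S -> X = G /\ b) -> #|S| <= b.
  case: b => SG; last by rewrite leqn0 cards_eq0 -subset0; apply/subsetP => X /SG[].
  have -> : true = #|[set G]| :> nat by rewrite cards1.
  apply: subset_leq_card.
  by apply/subsetP => X /SG[->]; rewrite inE.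
have C1 := card_le1 (blocksC G) ((is_cycle G && (4 <= #|vset G|)) || (4 <= #|vset G| <= 6)).
have D1 := card_le1 (blocksD G) (~~ is_cycle G && (7 <= #|vset G|)).
have {}C1 : #|blocksC G| <= (is_cycle G && (4 <= #|vset G|)) || (4 <= #|vset G| <= 6).
  by apply: C1 => X; rewrite inE => /andP[/(nonseparable_block nsG)-> ->].
have {}D1 : #|blocksD G| <= ~~ is_cycle G && (7 <= #|vset G|).
  by apply: D1 => X; rewrite inE => /andP[/(nonseparable_block nsG)-> ->].
have [G4|G4] := leqP 4 #|vset G|; last first.
  move: C1 D1; rewrite !(leqNgt _ #|vset G|) G4 (leq_trans G4) //= !andbF !leqn0.
  by move=> /eqP-> /eqP->; apply: deficient1.
have [/andP[ncyc G7]|nD] := boolP (~~ is_cycle G && (7 <= #|vset G|)).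
  apply: deficientW (nonseparable_deficient3 nsG ncyc G7).
  move: C1 D1; rewrite (negbTE ncyc) G4 /= (leqNgt _ 6) G7 leqn0 => /eqP-> /=.
  by case: #|_| => [|[]].
apply: deficientW (nonseparable_deficient2 nsG G4).
rewrite (negbTE nD) leqn0 in D1; rewrite (eqP D1) muln0 addn0 addn1 ltnS.
exact: leq_trans C1 (leq_b1 _).
Qed.

(** The vertex v is counted on both sides, so the orders add up to one more than that of G, while
    the numbers of colors just add. Hence the deficiencies minus 1 add. *)
Lemma deficient_glue G v C1 C2 d1 d2 :
  v \in vset G -> vset G = v |: (C1 :|: C2) -> v \notin C1 :|: C2 ->
  [disjoint C1 & C2] ->
  deficient (induced G (v |: C1)) d1.+1 -> deficient (induced G (v |: C2)) d2.+1 ->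
  deficient G (d1 + d2).+1.
Proof.
move=> vG VG vC dis [k1 H1 l1] [k2 H2 l2].
have V1 : vset G :&: (v |: C1) = v |: C1.
  by apply/setIidPr; rewrite VG setUS ?subsetUl.
have V2 : vset G :&: (v |: C2) = v |: C2.
  by apply/setIidPr; rewrite VG setUS ?subsetUr.
move: (vC); rewrite inE negb_or => /andP[vC1 vC2].
rewrite !vset_induced V1 V2 !cardsU1 vC1 vC2 in H1 H2 l1 l2.
exists (k1 + k2); last first.
  have := eqTleqif (leq_card_setU C1 C2) dis.
  by rewrite VG cardsU1 vC => ->; lia.
have -> : vset G = (v |: C1) :|: (v |: C2) by rewrite setUACA setUid.
apply: rx3_leS (rx3_le_glue H1 H2 (setU11 _ _) (setU11 _ _) _).
  by apply/subsetP => f; rewrite !inE => /orP[] /andP[].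
rewrite -setI_eq0 -subset0; apply/subsetP => f; rewrite !inE.
move=> /andP[/andP[fG f1] /andP[_ f2]].
(* An edge common to both sides would lie inside {v}, yet it has two vertices. *)
have : f \subset [set v].
  apply: subset_trans (_ : f \subset (v |: C1) :&: (v |: C2)) _.
    by rewrite subsetI f1 f2.
  by rewrite -setUIr (disjoint_setI0 dis) setU0.
move/subset_leq_card; rewrite cards1.
by have /forall_inP/(_ f fG)/andP[_ /eqP->] := graph_wf G.
Qed.

Lemma connected_deficient G : connected G ->
  deficient G (#|blocksC G| + 2 * #|blocksD G| + 1).
Proof.
have [n] := ubnP #|vset G|; elim: n G => // n IH G; rewrite ltnS => leG conG.
have [nsG|nsG] := boolP (nonseparable G); first exact: block_deficient.
have [v [C1 [C2 [vG VG [[vC dis C10 C20] sep]]]]] := separable_split conG nsG.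
have [C1G C2G] : C1 \subset vset G /\ C2 \subset vset G.
  by rewrite VG; split; apply/subsetP => x xC; rewrite !inE xC !orbT.
have nv x : x \in C1 :|: C2 -> x != v by move=> xC; apply: contraNneq vC => <-.
have adj_del x y : x \in C1 :|: C2 -> y \in C1 :|: C2 -> adj G x y ->
    connect (adj (del_vertex G v)) x y.
  move=> xC yC xy; apply: connect1; rewrite /adj inE; apply/andP; split=> //.
  by rewrite !inE negb_or !(eq_sym v) !nv.
have cl1 : {in C1, forall x y, adj G x y -> y != v -> y \in C1}.
  move=> x xC y xy yv; have /andP[_] := adj_vset xy.
  rewrite VG !inE (negbTE yv) /= => /orP[//|yC].
  by case/negP: (sep x y xC yC); apply: adj_del => //; rewrite inE ?xC ?yC ?orbT.
have cl2 : {in C2, forall x y, adj G x y -> y != v -> y \in C2}.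
  move=> x xC y xy yv; have /andP[_] := adj_vset xy.
  rewrite VG !inE (negbTE yv) /= => /orP[yC|//].
  case/negP: (sep y x yC xC); apply: adj_del; rewrite ?inE ?xC ?yC ?orbT //.
  by rewrite adj_sym.
pose G1 := induced G (v |: C1); pose G2 := induced G (v |: C2).
have cardG : #|vset G| = (#|C1| + #|C2|).+1.
  by rewrite VG cardsU1 vC (eqTleqif (leq_card_setU C1 C2) dis).
have cardV C : #|vset G :&: (v |: C)| <= #|C|.+1.
  by apply: leq_trans (subset_leq_card (subsetIr _ _)) _; rewrite cardsU1; case: (_ \notin _).
have {IH} [D1 D2] : deficient G1 (#|blocksC G1| + 2 * #|blocksD G1| + 1) /\
                    deficient G2 (#|blocksC G2| + 2 * #|blocksD G2| + 1).
  rewrite -!card_gt0 in C10 C20.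
  split; apply: IH; try exact: induced_connected.
    by apply: leq_ltn_trans (cardV C1) _; rewrite cardG in leG; lia.
  by apply: leq_ltn_trans (cardV C2) _; rewrite cardG in leG; lia.
(* A block with vertices in both C1 and C2 would connect them without v, being nonseparable; so it
   lies within one of the two sides. *)
have blockG B : is_block G B -> is_block G1 B || is_block G2 B.
  move=> blB; have /and3P[/andP[BG EBG] nsB _] := blB.
  have [B1|] := boolP (vset B \subset v |: C1); first by rewrite block_induced.
  case/subsetPn=> y yB yC1; rewrite orbC block_induced //.
  apply/subsetP => x xB; apply: contraR yC1 => xC2.
  have := subsetP BG x xB; have := subsetP BG y yB.
  move: xC2; rewrite VG !inE !negb_or => /andP[xv xC2].
  rewrite (negbTE xv) (negbTE xC2) /= orbF.
  have [//|yv] := eqVneq y v; rewrite /= => /orP[//|yC2] xC1.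
  case/negP: (sep x y xC1 yC2).
  apply: connect_sub (nonseparable_connect nsB xB yB xv yv) => a b.
  rewrite /adj inE => /andP[abB vab]; apply: connect1.
  by rewrite inE (subsetP EBG).
have leC : #|blocksC G| <= #|blocksC G1| + #|blocksC G2|.
  apply: leq_trans (subset_leq_card _) (leq_card_setU _ _).
  by apply/subsetP => B; rewrite !inE => /andP[/blockG/orP[]-> ->]; rewrite ?orbT.
have leD : #|blocksD G| <= #|blocksD G1| + #|blocksD G2|.
  apply: leq_trans (subset_leq_card _) (leq_card_setU _ _).
  by apply/subsetP => B; rewrite !inE => /andP[/blockG/orP[]-> ->]; rewrite ?orbT.
rewrite !addn1 in D1 D2 *.
by apply: deficientW (deficient_glue vG VG vC dis D1 D2); lia.
Qed.

End BlockInduction.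

(** * From linked triples to rainbow trees *)

Section RainbowIndex.
Variables (T : finType) (G : graph T).

Lemma component_wf (F : {set {set T}}) (W : {set T}) : F \subset eset G ->
  [forall f in [set f in F | f \subset W], (f \subset W) && (#|f| == 2)].
Proof.
move=> /subsetP FG; apply/forall_inP => f; rewrite inE => /andP[/FG fG ->].
by have /forall_inP/(_ f fG)/andP[_ ->] := graph_wf G.
Qed.

(** The component W of the rainbow set F that contains S is connected; a spanning tree of it is a
    rainbow tree. *)
Lemma has_3rainbow_coloring_of_rx3_le k : 3 <= #|vset G| ->
  rx3_le (vset G) (eset G) k -> has_3rainbow_coloring G k.
Proof.
(* Zero colors are ruled out first, since linking two vertices takes an edge; so k is a successor,
   as [inord] requires. *)
move=> G3 [c Hc]; case: k Hc => [|k] Hc.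
  have /card_gt1P[x [y [xG yG xy]]] : 1 < #|vset G| by apply: leq_trans G3.
  have [||F _ [_ lt con]] := Hc [set x; y].
  - by apply/subsetP => z /set2P[]->.
  - by rewrite cards2; case: (_ != _).
  have /connectP[[|z p] /= pP lastp] := con x y (set21 _ _) (set22 _ _).
    by rewrite lastp eqxx in xy.
  by case/andP: pP => /lt.
(* [inord] may change colors that are out of range, but those of the edges in F are below k.+1 and
   stay distinct. *)
apply/existsP; exists [ffun f => inord (c f)].
apply/forall_inP => S /andP[SG /eqP S3].
have [|F FG [inj lt con]] := Hc S SG; first by rewrite S3.
have [x xS] : exists x, x \in S by apply/card_gt0P; rewrite S3.
pose W := [set z in vset G | connect (eadj F) x z].
pose H := @Graph T (W, [set f in F | f \subset W]) (component_wf W FG).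
have WG z w : z \in W -> eadj F z w -> w \in W.
  rewrite !inE => /andP[zG xz] zw; rewrite (connect_trans xz (connect1 zw)) andbT.
  by have /andP[] := adj_vset (subsetP FG _ zw : adj G z w).
have xW : x \in W by rewrite inE (subsetP SG x xS) connect0.
have conp p u : u \in W -> path (eadj F) u p -> connect (adj H) u (last u p).
  elim: p u => //= w p IHp u uW /andP[uw pP]; have wW := WG u w uW uw.
  apply: connect_trans (connect1 _) (IHp w wW pP); rewrite /adj inE [_ \in F]uw.
  by apply/subsetP => z /set2P[]->.
have conH : connected H.
  apply/andP; split; first by apply/set0Pn; exists x.
  have toW z : z \in W -> connect (adj H) x z.
    by move=> zW; have := zW; rewrite inE => /andP[_ /connectP[p pP ->]]; apply: conp.
  apply/forall_inP => y yW; apply/forall_inP => z zW.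
  by apply: connect_trans (toW z zW); rewrite adj_connect_sym; apply: toW.
have [H' /andP[_ /subsetP EH'] [treeH' VH']] := spanning_tree conH.
have H'F f : f \in eset H' -> f \in F by move/EH'; rewrite inE => /andP[].
apply/existsP; exists H'; rewrite treeH' VH'; apply/and4P; split=> //.
- rewrite /subgraph VH'; apply/andP; split.
    by apply/subsetP => z; rewrite inE => /andP[].
  by apply/subsetP => f /H'F/(subsetP FG).
- apply/forall_inP => f /H'F fF; apply/forall_inP => g /H'F gF; apply/implyP.
  rewrite !ffunE => /eqP/(congr1 (@nat_of_ord _)); rewrite !inordK ?lt //.
  by move/(inj f g fF gF)->.
by apply/subsetP => y yS; rewrite inE (subsetP SG y yS) con.
Qed.

(** A tree containing all three vertices has an edge uw and a second edge leaving {u, w}; these need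
    two colors. *)
Lemma has_3rainbow_coloring_gt1 k : #|vset G| = 3 ->
  has_3rainbow_coloring G k -> 1 < k.
Proof.
move=> G3 /existsP[c /forall_inP/(_ (vset G))].
rewrite subxx G3 eqxx => /(_ isT)/existsP[H /and4P[/andP[_ _]]].
move=> /andP[/connectedP[_ con] _] /forall_inP rain /subsetP GH.
have : 0 < #|vset G| by rewrite G3.
case/card_gt0P=> x xG.
have [y yG yx] : exists2 y, y \in vset G & y != x.
  have : 0 < #|vset G :\ x| by move: G3; rewrite (cardsD1 x) xG; lia.
  by case/card_gt0P=> y /setD1P[]; exists y.
have [u [w [_ _ uw]]] : exists u w, [/\ u \in [set x], w \notin [set x] & adj H u w].
  by apply: connect_leaves (con x y (GH x xG) (GH y yG)) _ _; rewrite inE.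
have [z zG zuw] : exists2 z, z \in vset G & z \notin [set u; w].
  apply/subsetPn; apply: contraTN isT => /subset_leq_card.
  by rewrite G3 cards2; case: (_ != _).
have /andP[uH _] := adj_vset uw.
have [u' [w' [_ w'uw uw']]] := connect_leaves (con u z uH (GH z zG)) (set21 u w) zuw.
have := forall_inP (rain _ uw) _ uw'; case: k c {rain} => [|[|k]] // c.
  by case: (c [set u; w]).
rewrite !ord1 eqxx => /eqP e.
by case/negP: w'uw; rewrite e set22.
Qed.

End RainbowIndex.

(** * The bound and its equality case *)

Lemma complete_wf (T : finType) :
  [forall f in [set f : {set T} | #|f| == 2], (f \subset [set: T]) && (#|f| == 2)].
Proof. by apply/forall_inP => f; rewrite inE subsetT. Qed.

Definition complete_graph (T : finType) : graph T :=
  @Graph T ([set: T], [set f : {set T} | #|f| == 2]) (complete_wf T).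

Lemma complete_graph_connected (T : finType) (x : T) : connected (complete_graph T).
Proof.
apply/andP; split; first by apply/set0Pn; exists x; rewrite inE.
apply/forall_inP => u _; apply/forall_inP => v _.
have [->//|uv] := eqVneq u v; apply: connect1.
by rewrite /adj inE cards2 uv.
Qed.

Import Order.TTheory GRing.Theory Num.Theory.
Local Open Scope ring_scope.

Theorem theorem4p1 :
  (forall (T : finType) (G : graph T) (conG : connected G),
     (3 <= #|vset G|)%N ->
     (rx3 conG)%:Z <=
       #|vset G|%:Z - #|blocksC G|%:Z - 2 * #|blocksD G|%:Z - 1)
  /\
  (exists (T : finType) (G : graph T) (conG : connected G),
     (3 <= #|vset G|)%N /\
     (rx3 conG)%:Z =
       #|vset G|%:Z - #|blocksC G|%:Z - 2 * #|blocksD G|%:Z - 1).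
Proof.
have bound (T : finType) (G : graph T) (conG : connected G) : (3 <= #|vset G|)%N ->
    (rx3 conG)%:Z <= #|vset G|%:Z - #|blocksC G|%:Z - 2 * #|blocksD G|%:Z - 1.
  move=> G3; have [k /(has_3rainbow_coloring_of_rx3_le G3) colk kd] :=
    connected_deficient conG.
  have : (rx3 conG <= k)%N by rewrite /rx3; case: ex_minnP => m _; apply.
  move: kd; lia.
(* No block of the triangle has more than three vertices, so both families are empty and the bound
   is 2, which the lower bound matches. *)
split=> //; pose K3 := complete_graph 'I_3.
have conK3 : connected K3 := complete_graph_connected ord0.
have card3 : #|vset K3| = 3 by rewrite cardsT card_ord.
have le3 (X : graph 'I_3) : (#|vset X| <= 3)%N.
  by apply: leq_trans (max_card _) _; rewrite card_ord.
have C0 : #|blocksC K3| = 0%N.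
  apply/eqP; rewrite cards_eq0 -subset0; apply/subsetP => X; rewrite inE.
  by rewrite !(leqNgt 4) ltnS le3 andbF andbF.
have D0 : #|blocksD K3| = 0%N.
  apply/eqP; rewrite cards_eq0 -subset0; apply/subsetP => X; rewrite inE.
  by rewrite (leqNgt 7) ltnS (leq_trans (le3 X)) // !andbF.
exists 'I_3, K3, conK3; have := bound _ K3 conK3.
have : (1 < rx3 conK3)%N.
  by rewrite /rx3; case: ex_minnP => m /(has_3rainbow_coloring_gt1 card3).
rewrite card3 C0 D0 => lb /(_ isT) ub; split=> //; lia.
Qed.
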